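(* Let $p>2$ and let $m\in\mathbb{N}$ satisfy $m>(24p-12)/(p-2)$. Then there exist a Hilbert space $H$, commutative families $\{A_i\}_{i=1}^m$ and $\{B_i\}_{i=1}^m$ of normal operators in $\mathcal{B}(H)$, and an operator $T$ in the Schatten class $\mathcal{C}_p(H)$ such that $$\sum_{i=1}^m A_iTB_i=0\quad\text{and}\quad \sum_{i=1}^m A_i^*TB_i^*\neq 0.\qquad(\ast)$$ Moreover, if $m\geq 25$, there exist a Hilbert space $H$, commutative families $\{A_i\}_{i=1}^m$, $\{B_i\}_{i=1}^m$ of normal operators in $\mathcal{B}(H)$, and a compact operator $T$ on $H$ for which $(\ast)$ holds.
   Context: A commutative family of operators is one whose members commute pairwise: $A_iA_j=A_jA_i$ for all $i,j$, and $B_iB_j=B_jB_i$ for all $i,j$. $\mathcal{C}_p(H)$ is the Schatten $p$-class of operators on the Hilbert space $H$. *)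

(* Defs.v *)
From HB Require Import structures.
From mathcomp Require Import all_boot all_order all_algebra.
From mathcomp Require Import complex.
From mathcomp Require Import boolp classical_sets reals topology normedtype exp.

Set Implicit Arguments.
Unset Strict Implicit.
Unset Printing Implicit Defensive.

Import Order.TTheory GRing.Theory Num.Theory Num.Def.
Import numFieldNormedType.Exports.

Local Open Scope classical_set_scope.
Local Open Scope complex_scope.
Local Open Scope ring_scope.

(* The norm takes its values in R[i], as for every normed module over R[i];
   the inner product is linear in its first argument. *)
Record hilbertType (R : realType) := HilbertType {
  hilbert_sort :> completeNormedModType R[i];
  inner : {dot hilbert_sort for conjC};
  inner_norm : forall x : hilbert_sort, inner x x = `|x| ^+ 2
}.

Record bounded_operator (R : realType) (H : hilbertType R) := BoundedOperator {
  operator_fun :> {linear H -> H};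
  operator_continuous : continuous operator_fun
}.

Section Operators.
Variables (R : realType) (H : hilbertType R).
Implicit Types (T : bounded_operator H) (p : R).

(* By the Riesz representation theorem every bounded operator has exactly one
   adjoint, so the default value of [xget] is never taken. *)
Definition adjoint T : H -> H :=
  xget (fun=> 0)
    [set S : H -> H | forall x y, inner H (T x) y = inner H x (S y)].

Definition normal_operator T :=
  forall x, T (adjoint T x) = adjoint T (T x).

Definition compact_operator T :=
  precompact [set T x | x in [set x : H | `|x| <= 1]].

Definition orthonormal_family (n : nat) (e : 'I_n -> H) :=
  forall i j, inner H (e i) (e j) = (i == j)%:R.

(* The singular values of T are the nonnegative square roots of the eigenvalues
   of T^* T; the multiplicity of such an eigenvalue is the largest size of an
   orthonormal family of eigenvectors.  Hence s lists singular values of T, none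
   of them more often than its multiplicity. *)
Definition singular_values T (n : nat) (s : 'I_n -> R) :=
  (forall i, 0 <= s i) /\
  exists2 e : 'I_n -> H, orthonormal_family e &
    forall i, adjoint T (T (e i)) = (s i ^+ 2)%:C *: e i.

(* The p-th powers of the singular values of T, counted with multiplicity, are
   summable: their finite partial sums are bounded. *)
Definition schatten_class p T :=
  compact_operator T /\
  exists M : R, forall (n : nat) (s : 'I_n -> R),
    singular_values T s -> \sum_(i < n) s i `^ p <= M.

Definition commutative_family (m : nat) (A : 'I_m -> bounded_operator H) :=
  forall i j x, A i (A j x) = A j (A i x).

Definition sum_vanishes_but_not_adjoint_sum (m : nat)
    (A B : 'I_m -> bounded_operator H) T :=
  (forall x, \sum_(i < m) A i (T (B i x)) = 0) /\
  (exists x, \sum_(i < m) adjoint (A i) (T (adjoint (B i) x)) <> 0).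

End Operators.

(* Main.v *)
Require Import Defs.
From HB Require Import structures.
From mathcomp Require Import all_boot all_order all_algebra finmap.
From mathcomp Require Import complex.
From mathcomp Require Import boolp classical_sets functions reals topology.
From mathcomp Require Import normedtype exp.
From mathcomp Require Import ring lra zify.

(* Let m >= 4, let z_1, ..., z_m be the coordinate functions on the
   unit sphere S of C^m, and let Z_i be multiplication by z_i on L^2(S); the Z_i
   are commuting normal operators with sum_i Z_i^* Z_i = 1.  Let T act as the
   scalar nu_a on the harmonic polynomials of bidegree (a, a + 1) in (z, zbar),
   and as 0 on the other bidegrees.  Splitting z_i h into its harmonic components
   shows that sum_i Z_i^* T Z_i is again diagonal, with eigenvalues
   ((m + a - 1) mu(a + 1, b) + b mu(a, b - 1)) / (m + a + b - 1) where mu is the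
   diagonal of T; it vanishes if nu_0 = 1 and
   nu_{a+1} = - (a + 2) / (m + a - 1) nu_a.  On the other hand
   sum_i Z_i T Z_i^* 1 = nu_0 <> 0.  (T is the distribution dbar(delta_0)(<x, y>),
   which is killed by <x, y> but not by its complex conjugate.)  As
   |nu_a| <= C (a + 2)^{-(m-3)} and the multiplicities grow polynomially, T is
   compact, and it belongs to the Schatten class as soon as
   (m - 3) p >= 2 m + 2, which is implied by the hypothesis.

   L^2(S) is represented by families of coefficients of harmonic power series in
   2 m independent variables z_i, zbar_i, with a weighted l^2 norm. *)

Set Implicit Arguments.
Unset Strict Implicit.
Unset Printing Implicit Defensive.
Import Order.TTheory GRing.Theory Num.Theory Num.Def.
Import numFieldNormedType.Exports.
Local Open Scope classical_set_scope.
Local Open Scope complex_scope.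
Local Open Scope ring_scope.

(** * Unordered sums of complex numbers *)

Lemma normc_ge_Im (R : rcfType) (x : R[i]) : `|complex.Im x|%:C <= `|x|.
Proof. by rewrite normc_def lecR -sqrtr_sqr ler_wsqrtr// lerDr sqr_ge0. Qed.

Section HasSum.
Variables (R : realType) (I : choiceType).
Local Notation C := R[i].
Implicit Types (a b : I -> C) (l k : C) (A B : {fset I}).

(** Convergence along the directed set of finite subsets, so [I] needs neither an order nor
    countability. *)
Definition has_sum a l := forall e : C, 0 < e ->
  exists A, forall B, (A `<=` B)%fset -> `|l - \sum_(i <- B) a i| < e.

Lemma eq_has_sum a b l : a =1 b -> has_sum a l -> has_sum b l.
Proof. by move=> /funext ->. Qed.

Lemma has_sumD a b l k : has_sum a l -> has_sum b k ->
  has_sum (fun i => a i + b i) (l + k).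
Proof.
move=> al bk e e0.
have [A Al] := al _ (divr_gt0 e0 (ltr0n _ 2)).
have [B Bk] := bk _ (divr_gt0 e0 (ltr0n _ 2)).
exists (A `|` B)%fset => D; rewrite fsubUset => /andP[AD BD].
rewrite big_split/= opprD addrACA (le_lt_trans (ler_normD _ _))//.
by rewrite (splitr e) ltrD ?Al ?Bk.
Qed.

Lemma has_sumZ a l k : has_sum a l -> has_sum (fun i => k * a i) (k * l).
Proof.
move=> al e e0; have [->|k0] := eqVneq k 0.
  exists fset0 => B _; rewrite mul0r big1 ?subr0 ?normr0// => i _.
  by rewrite mul0r.
have nk : 0 < `|k| by rewrite normr_gt0.
have [A Al] := al _ (divr_gt0 e0 nk).
exists A => B /Al; rewrite -mulr_sumr -mulrBr normrM.
by rewrite ltr_pdivlMr// mulrC.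
Qed.

Lemma has_sum_conj a l :
  has_sum a l -> has_sum (fun i => conjC (a i)) (conjC l).
Proof.
move=> al e /al[A Al]; exists A => B /Al.
by rewrite -rmorph_sum -rmorphB norm_conjC.
Qed.

Lemma has_sum_unique a l k : has_sum a l -> has_sum a k -> l = k.
Proof.
move=> al ak; apply/eqP; rewrite -subr_eq0 -normr_eq0.
apply/negP => /negP lk0; have e0 : 0 < `|l - k| by rewrite lt_def lk0 normr_ge0.
have [A Al] := al _ (divr_gt0 e0 (ltr0n _ 2)).
have [B Bk] := ak _ (divr_gt0 e0 (ltr0n _ 2)).
have AB := ltrD (Al _ (fsubsetUl A B)) (Bk _ (fsubsetUr A B)).
have := le_lt_trans (ler_distD (\sum_(i <- (A `|` B)%fset) a i) l k).
rewrite [ `|_ - k|]distrC => /(_ _ AB).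
by rewrite -splitr ltxx.
Qed.

Lemma ler_sum_fsubset a A B : (forall i, 0 <= a i) -> (A `<=` B)%fset ->
  \sum_(i <- A) a i <= \sum_(i <- B) a i.
Proof.
move=> a0 /fsetIidPr AB; rewrite (big_fsetID _ (mem A) B)/=.
rewrite (_ : [fset x in B | x \in A]%fset = A).
  by rewrite lerDl sumr_ge0.
by rewrite -[RHS]AB; apply/fsetP => i; rewrite !inE.
Qed.

(** The nonnegative reals are closed in the complex plane: their distance to [d] is at least
    [|Im d|], and at least [- Re d] when [Re d < 0]. This is how limits pass through the partial
    order of [R[i]]. *)
Lemma ge0_approx (d : C) :
  (forall e : C, 0 < e -> exists2 x, 0 <= x & `|d - x| < e) -> 0 <= d.
Proof.
move=> H; rewrite lecE /=; apply/andP; split.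
  apply/negP => /negP Id.
  have /H[x x0] : 0 < `|complex.Im d|%:C by rewrite ltcR normr_gt0.
  suff : `|complex.Im d|%:C <= `|d - x| by move=> /le_lt_trans h /h; rewrite ltxx.
  have -> : complex.Im d = complex.Im (d - x).
    by case: d x x0 {H Id} => [p q] [p' q'] /ger0_Im /= ->; rewrite oppr0 addr0.
  exact: normc_ge_Im.
rewrite leNgt; apply/negP => d0.
have /H[x x0] : 0 < (- complex.Re d)%:C by rewrite ltcR oppr_gt0.
suff : (- complex.Re d)%:C <= `|d - x|.
  by move=> /le_lt_trans h /h; rewrite ltxx.
apply: le_trans (normc_ge_Re _); rewrite lecR.
case: d x x0 d0 {H} => [p q] [p' q']; rewrite lecE/= => /andP[_ p0] d0.
by rewrite ltr0_norm ?lerN2 ?lerBlDr ?lerDl// subr_lt0 (lt_le_trans d0).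
Qed.

Lemma has_sum_le a l : (forall i, 0 <= a i) -> has_sum a l ->
  forall A, \sum_(i <- A) a i <= l.
Proof.
move=> a0 al A; rewrite -subr_ge0; apply: ge0_approx => e /al[B Bl].
exists (\sum_(i <- (A `|` B)%fset) a i - \sum_(i <- A) a i).
  by rewrite subr_ge0 ler_sum_fsubset ?fsubsetUl.
by rewrite opprB addrA subrK Bl// fsubsetUr.
Qed.

Lemma has_sum_ub a l M : has_sum a l ->
  (forall A, \sum_(i <- A) a i <= M) -> l <= M.
Proof.
move=> al aM; rewrite -subr_ge0; apply: ge0_approx => e /al[B Bl].
exists (M - \sum_(i <- B) a i); first by rewrite subr_ge0.
by rewrite opprB addrC addrA subrK distrC Bl.
Qed.

Lemma has_sum_ge0_ex a M : (forall i, 0 <= a i) ->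
  (forall A, \sum_(i <- A) a i <= M) -> exists l, has_sum a l.
Proof.
move=> a0 aM.
(* The finite partial sums are real and increase with the finite set, so the sum is their
   supremum. *)
pose S := [set complex.Re (\sum_(i <- A) a i) | A in [set: {fset I}]].
have ReE A : (complex.Re (\sum_(i <- A) a i))%:C = \sum_(i <- A) a i.
  by rewrite RRe_real// ger0_real// sumr_ge0.
have Ssup : has_sup S.
  split; first by exists (complex.Re (\sum_(i <- fset0) a i)), fset0.
  exists (complex.Re M) => _ [A _ <-].
  by move: (aM A); rewrite lecE => /andP[].
exists (sup S)%:C => e e0.
have eE : (complex.Re e)%:C = e by rewrite RRe_real// gtr0_real.
have := e0; rewrite -eE ltcR => {}e0.
have [_ [A _ <-] SA] := sup_adherent e0 Ssup.
exists A => B AB; rewrite -ReE -rmorphB/= ger0_norm.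
  rewrite ltcR ltrBlDr -ltrBlDl (lt_le_trans SA)//.
  by rewrite -lecR !ReE ler_sum_fsubset.
by rewrite lecR subr_ge0; apply: sup_upper_bound => //; exists B.
Qed.

End HasSum.

Lemma has_sum_reindex (R : realType) (I K : choiceType) (h : K -> I)
    (h' : I -> K) (a : I -> R[i]) l :
  cancel h h' -> (forall i, h (h' i) != i -> a i = 0) ->
  has_sum a l -> has_sum (a \o h) l.
Proof.
(* An index of [A] outside the image of [B] under [h] is not a value of [h] at all, so [a] vanishes
   there and the sum over [B] equals the sum over the union of [A] and that image. *)
move=> hK a0 al e /al[A Al]; exists (h' @` A)%fset => B hAB.
rewrite (_ : \sum_(k <- B) _ = \sum_(i <- (A `|` h @` B)%fset) a i).
  by rewrite Al ?fsubsetUl.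
rewrite -(big_fset_incl _ (fsubsetUr A (h @` B)%fset)).
  by rewrite big_imfset//= => x y _ _; exact: can_inj.
move=> i; rewrite inE => /orP[iA|->//] ihB; apply: a0.
apply: contra ihB => /eqP <-; rewrite in_imfset//=.
by apply: (fsubsetP hAB); rewrite in_imfset.
Qed.

(** * Weighted l^2 spaces with a closed linear constraint *)

Section DotLmodule.
Variables (C : numClosedFieldType) (U : lmodType C) (form : {dot U for conjC}).
Local Notation "''[' u , v ]" := (form u%R v%R) : ring_scope.
Local Notation "''[' u ]" := '[u, u]%R : ring_scope.

Lemma dot_CauchySchwarz u v : `|'[u, v]| ^+ 2 <= '[u] * '[v].
Proof.
have [->|v0] := eqVneq v 0; first by rewrite !linear0r normr0 expr0n mulr0.
have vv : 0 < '[v] by rewrite dnorm_gt0.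
(* This is the squared norm of the component of [u] orthogonal to [v]. *)
have : 0 <= '[u - ('[u, v] / '[v]) *: v] by exact: dnorm_ge0.
rewrite linearBl/= !linearBr/= !linearZr_LR/= !linearZl_LR/=.
have -> : '[v, u] = conjC '[u, v] by rewrite hermC expr0 mul1r.
rewrite rmorphM fmorphV/= (geC0_conj (dnorm_ge0 _ _)).
set d := '[u, v]; set V := '[v].
have V0 : V != 0 by rewrite gt_eqF.
set dc := conjC d.
rewrite normCK -/dc.
rewrite [X in 0 <= X -> _](_ : _ = '[u] - d * dc / V); last by field.
by rewrite subr_ge0 ler_pdivrMr.
Qed.

Lemma dot_triangle u v : sqrtC '[u + v] <= sqrtC '[u] + sqrtC '[v].
Proof.
rewrite -ler_sqr ?nnegrE ?addr_ge0 ?sqrtC_ge0 ?dnorm_ge0//.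
rewrite sqrrD !sqrtCK dnormD/= [X in _ <= X]addrAC lerD2l.
rewrite -mulr_natr -[_ + _](divfK (negbT (pnatr_eq0 C 2))) -ReE.
rewrite ler_pM2r ?ltr0n//.
apply: le_trans (leif_Re_Creal _).1 _.
rewrite -sqrtCM ?nnegrE ?dnorm_ge0// -[leLHS](sqrCK (normr_ge0 _)).
by rewrite ler_sqrtC ?nnegrE ?exprn_ge0 ?mulr_ge0 ?dnorm_ge0// dot_CauchySchwarz.
Qed.
End DotLmodule.

Section WeightedL2.
Variables (R : realType) (I : choiceType).
Local Notation C := R[i].

Record weight := Weight {
  weight_fun :> I -> R;
  weight_gt0 : forall i, 0 < weight_fun i }.

(* The closedness is with respect to pointwise convergence. *)
Record coef_space := CoefSpace {
  coef_pred :> {pred I -> C};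
  coef_submod : submod_closed coef_pred;
  coef_closed : forall f, (forall (A : {fset I}) (e : C), 0 < e ->
      exists2 g, g \in coef_pred & forall i, i \in A -> `|f i - g i| < e) ->
    f \in coef_pred }.

Variables (w : weight) (E : coef_space).
Implicit Types f g h : I -> C.

Definition l2_term f g i : C := (w i)%:C * (f i * conjC (g i)).

Lemma wC_gt0 i : 0 < (w i)%:C :> C. Proof. by rewrite ltcR weight_gt0. Qed.

Lemma l2_term_ge0 f i : 0 <= l2_term f f i.
Proof. by rewrite mulr_ge0 ?mul_conjC_ge0// ltW ?wC_gt0. Qed.

Definition square_summable f :=
  exists M, forall A : {fset I}, \sum_(i <- A) l2_term f f i <= M.

Lemma square_summable_linear k f g : square_summable f -> square_summable g ->
  square_summable (k *: f + g).
Proof.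
(* The constant comes from [|x + y|^2 <= 2 (|x|^2 + |y|^2)]. *)
move=> [M fM] [N gN]; exists (2 * (`|k| ^+ 2 * M + N)) => A.
have le_term i : l2_term (k *: f + g) (k *: f + g) i <=
    2 * (`|k| ^+ 2 * l2_term f f i + l2_term g g i).
  rewrite [leRHS](_ : _ = (w i)%:C * (2 * (`|k * f i| ^+ 2 + `|g i| ^+ 2))).
    2: by rewrite /l2_term !normCK rmorphM; ring.
  rewrite /l2_term ler_pM2l ?wC_gt0// -normCK.
  rewrite [(k *: f + g) i](_ : _ = k * f i + g i)//.
  set x := k * f i; set y := g i.
  have xy := ler_normD x y.
  rewrite (le_trans (lerXn2r 2 _ _ xy)) ?nnegrE ?addr_ge0//.
  rewrite -subr_ge0 [_ - _](_ : _ = (`|x| - `|y|) ^+ 2); last first.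
    by rewrite sqrrB sqrrD mulrDr !mulr_natl !mulr2n; ring.
  by rewrite real_exprn_even_ge0// realB ?normr_real.
apply: le_trans (ler_sum _ (fun i _ => le_term i)) _.
rewrite -mulr_sumr ler_pM2l ?ltr0n// big_split/= -mulr_sumr lerD//.
by rewrite ler_wpM2l ?exprn_ge0.
Qed.

Definition l2_pred : {pred I -> C} := [pred f | (f \in E) && `[< square_summable f >]].

Lemma l2_submod : submod_closed l2_pred.
Proof.
split.
  rewrite inE (coef_submod E).1/=.
  apply/asboolP; exists 0 => A; rewrite big1// => i _.
  by rewrite /l2_term mul0r mulr0.
move=> k f g; rewrite !inE => /andP[fE /asboolP f2] /andP[gE /asboolP g2].
rewrite (coef_submod E).2//=; apply/asboolP; exact: square_summable_linear.
Qed.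

HB.instance Definition _ := GRing.isSubmodClosed.Build _ _ l2_pred l2_submod.

Record l2_space := L2Space { l2_fun :> I -> C; _ : l2_fun \in l2_pred }.

HB.instance Definition _ := [isSub for l2_fun].
HB.instance Definition _ := [Choice of l2_space by <:].
HB.instance Definition _ := [SubChoice_isSubLmodule of l2_space by <:].

Implicit Types u v : l2_space.

Lemma l2_in_coef u : (u : I -> C) \in E.
Proof. by case: u => f /=; rewrite inE => /andP[]. Qed.

Lemma l2_square_summable u : square_summable u.
Proof. by case: u => f /=; rewrite inE => /andP[_ /asboolP]. Qed.

Lemma l2P u v : (forall i, u i = v i) -> u = v.
Proof. by move=> uv; apply/val_inj/funext. Qed.

Lemma l2_subE u v i : (u - v) i = u i - v i.
Proof. by []. Qed.

(** Defined on all coefficient families, because intermediate operators such as multiplication by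
    one variable leave [E]. The default 0 occurs only if the series has no sum, which
    [has_sum_coef_inner] excludes for square-summable families. *)
Definition coef_inner f g : C := xget 0 [set l | has_sum (l2_term f g) l].

Lemma has_sum_square f : square_summable f -> exists l, has_sum (l2_term f f) l.
Proof. by move=> [M fM]; exact: has_sum_ge0_ex (l2_term_ge0 f) fM. Qed.

(** Polarization writes the terms as a combination of the four nonnegative families attached to
    [k f + g] with [k] = 1, -1, i, -i, and these have sums by monotonicity. *)
Lemma has_sum_coef_inner f g : square_summable f -> square_summable g ->
  has_sum (l2_term f g) (coef_inner f g).
Proof.
move=> f2 g2.
suff [l fl] : exists l, has_sum (l2_term f g) l by apply: (xgetPex 0); exists l.
have sq k : exists l, has_sum (l2_term (k *: f + g) (k *: f + g)) l.
  exact/has_sum_square/square_summable_linear.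
have [a ha] := sq 1; have [b hb] := sq (-1).
have [c hc] := sq 'i%R; have [d hd] := sq (- 'i%R).
exists (4^-1 * (a + (-1) * b + (- 'i%R) * c + 'i%R * d)).
apply: eq_has_sum (has_sumZ _ (has_sumD (has_sumD (has_sumD ha
  (has_sumZ (-1) hb)) (has_sumZ (- 'i%R) hc)) (has_sumZ 'i%R hd))).
have conjL (k x y : C) : conjC (k * x + y) = conjC k * conjC x + conjC y.
  by rewrite rmorphD rmorphM.
have conjNi : conjC (- 'i%R) = 'i%R :> C by rewrite rmorphN/= conjCi opprK.
have linE k i : (k *: f + g) i = k * f i + g i by [].
move=> i; rewrite /l2_term !linE !conjL conjC1 conjCN1 conjCi conjNi.
set x := f i; set y := g i; set x' := conjC x; set y' := conjC y.
have ii : 'i%R * 'i%R = -1 :> C by rewrite -expr2 sqrCi.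
set j := 'i%R in ii *; set W := (w i)%:C.
transitivity (4^-1 * W * (2 * (x * y' + y * x') - 2 * (j * j) * (x * y' - y * x'))).
  by field.
by rewrite ii; field.
Qed.

Lemma coef_innerP f g l : has_sum (l2_term f g) l -> coef_inner f g = l.
Proof.
move=> fl; apply: (has_sum_unique _ fl).
by apply: (xgetPex 0 (P := [set l | has_sum (l2_term f g) l])); exists l.
Qed.

Lemma coef_inner_linearl k f f' g : square_summable f -> square_summable f' ->
  square_summable g ->
  coef_inner (k *: f + f') g = k * coef_inner f g + coef_inner f' g.
Proof.
move=> f2 f'2 g2; apply: coef_innerP; apply: eq_has_sum (has_sumD
  (has_sumZ k (has_sum_coef_inner f2 g2)) (has_sum_coef_inner f'2 g2)) => i.
have linE : (k *: f + f') i = k * f i + f' i by [].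
by rewrite /l2_term linE; ring.
Qed.

Lemma coef_innerC f g : square_summable f -> square_summable g ->
  coef_inner f g = conjC (coef_inner g f).
Proof.
move=> f2 g2; apply: coef_innerP.
apply: eq_has_sum (has_sum_conj (has_sum_coef_inner g2 f2)) => i.
by rewrite /l2_term !rmorphM/= conjCK conj_Creal ?complex_real//; ring.
Qed.

Definition l2_inner u v : C := coef_inner u v.

Lemma has_sum_inner u v : has_sum (l2_term u v) (l2_inner u v).
Proof. exact/has_sum_coef_inner/l2_square_summable/l2_square_summable. Qed.

Lemma l2_inner_linearl v : GRing.linear_for *%R (l2_inner^~ v).
Proof.
by move=> k u u'; apply: coef_inner_linearl; exact: l2_square_summable.
Qed.

Lemma l2_inner_herm u v : l2_inner u v = (-1) ^+ false * conjC (l2_inner v u).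
Proof. by rewrite mul1r; apply: coef_innerC; exact: l2_square_summable. Qed.

Lemma l2_inner_linearr u : GRing.linear_for (conjC \; *%R) (l2_inner u).
Proof.
move=> k v v'; rewrite 3!(l2_inner_herm u) expr0 !mul1r.
by rewrite l2_inner_linearl rmorphD rmorphM.
Qed.

Lemma l2_coord_le u i : (w i)%:C * `|u i| ^+ 2 <= l2_inner u u.
Proof.
have := has_sum_le (l2_term_ge0 u) (has_sum_inner u u) [fset i]%fset.
by rewrite big_seq_fset1 /l2_term normCK.
Qed.

Lemma l2_inner_gt0 u : u != 0 -> 0 < l2_inner u u.
Proof.
move=> u0; have [i ui] : exists i, u i != 0.
  apply: contrapT => /forallNP H; move/eqP: u0; apply; apply: l2P => i.
  by have /negP := H i; rewrite negbK => /eqP.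
apply: lt_le_trans (l2_coord_le u i).
by rewrite mulr_gt0 ?wC_gt0// exprn_gt0// normr_gt0.
Qed.

HB.instance Definition _ := bilinear_isBilinear.Build C l2_space l2_space C
  *%R (conjC \; *%R) l2_inner (l2_inner_linearl, l2_inner_linearr).
HB.instance Definition _ := isHermitianSesquilinear.Build C l2_space false
  conjC l2_inner l2_inner_herm.
HB.instance Definition _ := isDotProduct.Build C l2_space l2_inner l2_inner_gt0.

Definition l2_norm u : C := sqrtC (l2_inner u u).

Lemma l2_normD u v : l2_norm (u + v) <= l2_norm u + l2_norm v.
Proof. exact: dot_triangle. Qed.

Lemma l2_normZ k u : l2_norm (k *: u) = `|k| * l2_norm u.
Proof.
by rewrite /l2_norm dnormZ/= sqrtCM ?nnegrE ?exprn_ge0 ?dnorm_ge0// sqrCK.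
Qed.

Lemma l2_norm_eq0 u : l2_norm u = 0 -> u = 0.
Proof. by move/eqP; rewrite sqrtC_eq0 dnorm_eq0 => /eqP. Qed.

HB.instance Definition _ :=
  Lmodule_isNormed.Build C l2_space l2_normD l2_normZ l2_norm_eq0.

Lemma l2_inner_norm u : l2_inner u u = `|u| ^+ 2.
Proof. by rewrite sqrtCK. Qed.

End WeightedL2.

(** * Limits of complex-valued functions and completeness of weighted l^2 *)

Lemma complex_near_limit (R : realType) (T : Type) (F : set_system T)
    (f : T -> R[i]) (a b : R) : Filter F ->
  complex.Re (f t) @[t --> F] --> a -> complex.Im (f t) @[t --> F] --> b ->
  forall e : R[i], 0 < e -> \forall t \near F, `|a +i* b - f t| < e.
Proof.
move=> FF fa fb e e0.
have eE : (complex.Re e)%:C = e by rewrite RRe_real// gtr0_real.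
have d0 : 0 < complex.Re e / 2 by rewrite divr_gt0// -ltcR eE.
move/cvgrPdist_lt : fa => /(_ _ d0) fa; move/cvgrPdist_lt : fb => /(_ _ d0) fb.
apply: filterS2 fa fb => t; case: (f t) => x y /= ax bx.
have -> : a +i* b - (x +i* y) = (a - x)%:C + 'i%C * (b - y)%:C.
  by rewrite [LHS]complexE.
rewrite (le_lt_trans (ler_normD _ _))// normrM -eE [in ltRHS](splitr (complex.Re e)).
rewrite !normc_def /= !expr0n /= !(addr0, add0r) !sqrtr_sqr normr1 mul1r -rmorphD/=.
by rewrite ltcR ltrD.
Qed.

Lemma complex_cauchy_limit (R : realType) (T : Type) (F : set_system T)
    (f : T -> R[i]) : ProperFilter F ->
  (forall e : R[i], 0 < e -> exists z, \forall t \near F, `|z - f t| < e) ->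
  exists l, forall e : R[i], 0 < e -> \forall t \near F, `|l - f t| < e.
Proof.
move=> FF fC.
(* Real and imaginary parts are 1-Lipschitz, so each has a Cauchy image in [R]. *)
have part (p : R[i] -> R) : {morph p : x y / x - y} ->
    (forall x, `|p x|%:C <= `|x|) -> exists l : R, p (f t) @[t --> F] --> l.
  move=> pB ple; apply/cvg_ex; apply: R_complete.
  apply/cauchyP => e e0.
  have [|z zP] := fC e%:C; first by rewrite ltcR.
  exists (p z); rewrite nbhs_filterE; apply: filterS zP => t zt.
  by rewrite -ball_normE /ball_/= -ltcR -pB (le_lt_trans (ple _)).
have [||a fa] := part (@complex.Re R).
- by case=> ? ? [].
- exact: normc_ge_Re.
have [||b fb] := part (@complex.Im R).
- by case=> ? ? [].
- exact: normc_ge_Im.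
exists (a +i* b); exact: complex_near_limit.
Qed.

Section Completeness.
Variables (R : realType) (I : choiceType) (w : weight R I) (E : coef_space R I).
Local Notation C := R[i].
Local Notation H := (l2_space w E).

Lemma l2_coord_norm (u : H) i : (w i)%:C * `|u i| ^+ 2 <= `|u| ^+ 2.
Proof. by rewrite -l2_inner_norm l2_coord_le. Qed.

Lemma l2_norm_ub (u : H) (M : C) : 0 <= M ->
  (forall A : {fset I}, \sum_(i <- A) l2_term w u u i <= M ^+ 2) -> `|u| <= M.
Proof.
move=> M0 uM; rewrite -ler_sqr ?nnegrE// -l2_inner_norm.
exact: has_sum_ub (has_sum_inner u u) uM.
Qed.

Lemma l2_sum_le_norm (u : H) (A : {fset I}) :
  \sum_(i <- A) l2_term w u u i <= `|u| ^+ 2.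
Proof.
rewrite -l2_inner_norm; apply: has_sum_le (has_sum_inner u u) A.
exact: l2_term_ge0.
Qed.

Lemma l2_term_leD (f g : I -> C) i : l2_term w (f + g) (f + g) i <=
  2 * (l2_term w f f i + l2_term w g g i).
Proof.
rewrite [leRHS](_ : _ = (w i)%:C * (2 * (`|f i| ^+ 2 + `|g i| ^+ 2))); last first.
  by rewrite /l2_term !normCK; ring.
rewrite /l2_term ler_pM2l ?wC_gt0// -normCK.
have xy := ler_normD (f i) (g i).
rewrite (le_trans (lerXn2r 2 _ _ xy)) ?nnegrE ?addr_ge0//.
rewrite -subr_ge0 [_ - _](_ : _ = (`|f i| - `|g i|) ^+ 2); last by ring.
by rewrite real_exprn_even_ge0// realB ?normr_real.
Qed.

(** Each coordinate is Lipschitz for the norm, so [F] converges coordinatewise; the limit [g]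
    satisfies the constraint by [coef_closed], and [near_g] yields both its square-summability and
    convergence in norm. *)
Lemma l2_complete (F : set_system H) : ProperFilter F -> cauchy F -> cvg F.
Proof.
move=> FF /cauchyP FC.
have FCn (e : C) : 0 < e -> exists u0 : H, \forall u \near F, `|u0 - u| < e.
  by move=> /FC[u0]; rewrite -ball_normE; exists u0.
have /choice[g gP] : forall i, exists gi : C, forall e : C, 0 < e ->
    \forall u \near F, `|gi - (u : H) i| < e.
  move=> i.
  apply: complex_cauchy_limit => e e0.
  have wi := wC_gt0 w i.
  have [|u0 u0P] := FCn (e * sqrtC (w i)%:C); first by rewrite mulr_gt0 ?sqrtC_gt0.
  exists (u0 i); apply: filterS u0P => u uu0.
  rewrite -(ltr_pM2r (x := sqrtC (w i)%:C)) ?sqrtC_gt0//.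
  apply: le_lt_trans uu0.
  rewrite -ler_sqr ?nnegrE ?mulr_ge0 ?normr_ge0 ?sqrtC_ge0 ?(ltW wi)//.
  by rewrite exprMn sqrtCK mulrC; exact: (l2_coord_norm (u0 - u) i).
have gA (A : {fset I}) (e : C) : 0 < e ->
    \forall u \near F, forall i, i \in A -> `|g i - (u : H) i| < e.
  move=> e0; apply: filterS (filter_bigI FF (fun i (_ : i \in A) => gP i e e0)).
  by move=> u + i iA; apply.
have near_g (u0 : H) (e : C) : 0 < e -> (\forall u \near F, `|u0 - u| < e) ->
    forall A : {fset I}, \sum_(i <- A) l2_term w (g - u0) (g - u0) i <= (2 * e) ^+ 2.
  move=> e0 u0P A.
  (* With precision [e / sqrtC W] in every coordinate of [A], the weighted error on [A] is at most
     [e^2]. The point [u] found below depends on [A], but the resulting bound does not. *)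
  pose W := 1 + \sum_(i <- A) (w i)%:C : C.
  have W1 : 1 <= W by rewrite lerDl sumr_ge0// => i _; rewrite ltW ?wC_gt0.
  have W0 : 0 < W by apply: lt_le_trans W1.
  have d0 : 0 < e / sqrtC W by rewrite divr_gt0 ?sqrtC_gt0.
  have [u [gu u0u]] := filter_ex (filterI (gA A _ d0) u0P).
  apply: (@le_trans _ _ (\sum_(i <- A)
    2 * (l2_term w (g - u) (g - u) i + l2_term w (u - u0) (u - u0) i))).
    apply: ler_sum => i _.
    rewrite [X in l2_term _ X X _](_ : _ = (g - (u : I -> C)) + (u - u0 : H)).
      exact: l2_term_leD.
    by apply/funext => j /=; rewrite !fctE addrA subrK.
  rewrite -mulr_sumr [leRHS](_ : _ = 2 * (e ^+ 2 + e ^+ 2)); last by ring.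
  rewrite ler_pM2l// big_split/= lerD//; last first.
    apply: le_trans (l2_sum_le_norm (u - u0) A) _.
    by rewrite ler_sqr ?nnegrE ?(ltW e0)// distrC ltW.
  apply: (@le_trans _ _ (\sum_(i <- A) (w i)%:C * (e ^+ 2 / W))).
    rewrite big_seq [leRHS]big_seq; apply: ler_sum => i iA.
    rewrite /l2_term ler_pM2l ?wC_gt0// -normCK.
    rewrite -[leRHS](_ : (e / sqrtC W) ^+ 2 = _); last by rewrite expr_div_n sqrtCK.
    by rewrite ler_sqr ?nnegrE ?(ltW d0)// ltW ?gu.
  rewrite -mulr_suml mulrCA ler_piMr ?exprn_ge0 ?(ltW e0)//.
  by rewrite ler_pdivrMr// mul1r lerDr.
have gl2 : g \in l2_pred w E.
  rewrite inE; apply/andP; split.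
    apply: coef_closed => A e e0; have [u uP] := filter_ex (gA A e e0).
    by exists u => //; exact: l2_in_coef.
  have [u0 u0P] := FCn 1 ltr01.
  have : square_summable w (1 *: (g - (u0 : I -> C)) + (u0 : I -> C)).
    apply: square_summable_linear; last exact: l2_square_summable.
    by exists ((2 * 1) ^+ 2); exact: near_g.
  by rewrite scale1r subrK => ?; apply/asboolP.
pose g' := L2Space gl2.
apply/cvg_ex; exists g'; apply/cvgrPdist_lt => /= e e0.
have e4 : 0 < e / 4 by rewrite divr_gt0.
have [u0 u0P] := FCn _ e4.
have gu0 : `|g' - u0| <= 2 * (e / 4).
  apply: (@l2_norm_ub (g' - u0)); first by rewrite mulr_ge0 ?(ltW e4).
  exact: near_g e4 u0P.
apply: filterS u0P => u u0u.
rewrite (le_lt_trans (ler_distD u0 _ _))//.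
rewrite (lt_le_trans (ler_ltD gu0 u0u))// -subr_ge0.
by rewrite [_ - _](_ : _ = e / 4) ?(ltW e4)//; field.
Qed.

HB.instance Definition _ := Uniform_isComplete.Build H l2_complete.
End Completeness.

Definition l2_hilbert (R : realType) (I : choiceType) (w : weight R I)
    (E : coef_space R I) : hilbertType R :=
  @HilbertType R (l2_space w E) (@l2_inner R I w E) (@l2_inner_norm R I w E).

(** * Relatively compact subsets of l^2 *)

(** Compactness of [[-K, K]] gives a cluster point of the image, and an ultrafilter converges to its
    cluster points. *)
Lemma ultra_bounded_limit (R : realType) (T : Type) (F : set_system T)
    (f : T -> R) (K : R) : UltraFilter F ->
  (\forall t \near F, `|f t| <= K) -> exists l : R, f t @[t --> F] --> l.
Proof.
move=> FU fK.
have FK : (f t @[t --> F]) `[- K, K]%classic.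
  by apply: filterS fK => t; rewrite /= in_itv/= ler_norml.
have [l [_ lcl]] := @segment_compact R (- K) K _ _ FK.
exists l => N Nl; have [//|FN] := in_ultra_setVsetC (f @^-1` N) FU.
by have [x []] := lcl (~` N) N FN Nl.
Qed.

Section L2Compact.
Variables (R : realType) (I : choiceType) (w : weight R I) (E : coef_space R I).
Local Notation C := R[i].
Local Notation H := (l2_space w E).

(** An ultrafilter on the closure converges in each coordinate by boundedness. Finitely many
    coordinates are then almost constant and the remaining ones are uniformly small, so the
    ultrafilter is Cauchy. *)
Lemma l2_precompact (S : set H) (K : C) : (forall u, S u -> `|u| <= K) ->
  (forall e : C, 0 < e -> exists A : {fset I}, forall u, S u ->
    forall B : {fset I}, (forall i, i \in B -> i \notin A) ->
      \sum_(i <- B) l2_term w u u i <= e ^+ 2) ->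
  precompact S.
Proof.
move=> SK tail; rewrite precompactE compact_ultra.
suff ult (F : set_system H) : UltraFilter F -> F (closure S) ->
  closure S `&` [set p | F --> p] !=set0 by exact: ult.
move=> FU FS.
have clS (e : C) : 0 < e -> forall u, closure S u -> exists2 v, S v & `|u - v| < e.
  move=> e0 u /(_ _ (nbhsx_ballx u _ e0))[v [Sv]].
  by rewrite -ball_normE; exists v.
have clK u : closure S u -> `|u| <= K + 1.
  move=> /(clS _ ltr01)[v /SK vK uv]; rewrite -[u](subrK v) addrC.
  by rewrite (le_trans (ler_normD _ _))// lerD// ltW.
have limF i : exists l : C, forall e : C, 0 < e ->
    \forall u \near F, `|l - (u : H) i| < e.
  have wi := wC_gt0 w i.
  have bd u : closure S u -> `|(u : H) i| <= (K + 1) / sqrtC (w i)%:C.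
    move=> /clK uK; rewrite ler_pdivlMr ?sqrtC_gt0//; apply: le_trans uK.
    rewrite -ler_sqr ?nnegrE ?mulr_ge0 ?normr_ge0 ?sqrtC_ge0 ?(ltW wi)//.
    by rewrite exprMn sqrtCK mulrC l2_coord_norm.
  have [|a fa] := @ultra_bounded_limit R H F (fun u => complex.Re (u i))
    (complex.Re ((K + 1) / sqrtC (w i)%:C)).
    apply: filterS FS => u /bd; rewrite lecE => /andP[_]; apply: le_trans.
    by rewrite -lecR (le_trans (normc_ge_Re _))// RRe_real ?normr_real.
  have [|b fb] := @ultra_bounded_limit R H F (fun u => complex.Im (u i))
    (complex.Re ((K + 1) / sqrtC (w i)%:C)).
    apply: filterS FS => u /bd; rewrite lecE => /andP[_]; apply: le_trans.
    by rewrite -lecR (le_trans (normc_ge_Im _))// RRe_real ?normr_real.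
  exists (a +i* b); exact: complex_near_limit.
suff FC : cauchy F.
  have Fp := @l2_complete R I w E F _ FC; exists (lim F); split; last exact: Fp.
  apply: closed_closure => N /Fp FN.
  exact: filter_ex (filterI FS FN).
apply/cauchyP => e e0.
(* For [d = e / 8], the coordinates in [A] contribute at most [4 d^2] to the squared distance and
   the others at most [16 d^2], which gives a distance of at most [5 d < e]. *)
have d0 : 0 < e / 8 by rewrite divr_gt0.
set d := e / 8 in d0.
have [A tailA] := tail _ d0.
have tailC u : closure S u -> forall B : {fset I},
    (forall i, i \in B -> i \notin A) ->
    \sum_(i <- B) l2_term w u u i <= (2 * d) ^+ 2.
  move=> /(clS _ d0)[v Sv uv] B BA.
  rewrite [leRHS](_ : _ = 2 * (d ^+ 2 + d ^+ 2)); last by ring.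
  apply: (@le_trans _ _ (\sum_(i <- B)
    2 * (l2_term w (u - v) (u - v) i + l2_term w v v i))).
    apply: ler_sum => i _.
    rewrite [X in l2_term _ X X _](_ : _ = ((u - v : H) : I -> C) + (v : I -> C)).
      exact: l2_term_leD.
    by apply/funext => j /=; rewrite !fctE subrK.
  rewrite -mulr_sumr ler_pM2l// big_split/= lerD//; last exact: tailA.
  apply: le_trans (l2_sum_le_norm (u - v) B) _.
  by rewrite ler_sqr ?nnegrE ?(ltW d0)// ltW.
have [l lP] := choice limF.
pose W := 1 + \sum_(i <- A) (w i)%:C : C.
have W1 : 1 <= W by rewrite lerDl sumr_ge0// => i _; rewrite ltW ?wC_gt0.
have W0 : 0 < W by apply: lt_le_trans W1.
have c0 : 0 < d / sqrtC W by rewrite divr_gt0 ?sqrtC_gt0.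
have near_l : \forall u \near F, forall i, i \in A -> `|l i - (u : H) i| < d / sqrtC W.
  apply: filterS (filter_bigI _ (fun i (_ : i \in A) => lP i _ c0)).
  by move=> u + i iA; apply.
have [v [Sv lv]] := filter_ex (filterI FS near_l).
exists v; apply: filterS2 FS near_l => u Su lu.
rewrite -ball_normE /ball_/=.
have le5 : `|v - u| <= 5 * d.
  apply: l2_norm_ub => [|B]; first by rewrite mulr_ge0// ltW.
  rewrite (big_fsetID _ (mem A))/= [leRHS](_ : _ = 4 * d ^+ 2 + 21 * d ^+ 2).
    2: by ring.
  have d2 : 0 <= d ^+ 2 by rewrite exprn_ge0// ltW.
  rewrite lerD//.
    apply: (@le_trans _ _ (\sum_(i <- A) l2_term w (v - u) (v - u) i)).
      apply: ler_sum_fsubset; first exact: l2_term_ge0.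
      by apply/fsubsetP => i; rewrite !inE => /andP[].
    apply: (@le_trans _ _ (\sum_(i <- A) (w i)%:C * (4 * (d ^+ 2 / W)))).
      rewrite big_seq [leRHS]big_seq; apply: ler_sum => i iA.
      rewrite /l2_term ler_pM2l ?wC_gt0// -normCK.
      have -> : 4 * (d ^+ 2 / W) = (d / sqrtC W + d / sqrtC W) ^+ 2.
        by rewrite -(sqrtCK W) -expr_div_n sqrtCK; ring.
      rewrite ler_sqr ?nnegrE ?addr_ge0 ?(ltW c0)//.
      rewrite l2_subE (le_trans (ler_distD (l i) _ _))// lerD// ltW ?lu//.
      by rewrite distrC lv.
    rewrite -mulr_suml mulrCA ler_pM2l// mulrCA ler_piMr//.
    by rewrite ler_pdivrMr// mul1r lerDr.
  apply: (@le_trans _ _ (\sum_(i <- [fset x in B | x \notin A]%fset)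
    2 * (l2_term w v v i + l2_term w u u i))).
    apply: ler_sum => i _.
    rewrite -[l2_term w u u i](_ : l2_term w (- (u : I -> C)) (- (u : I -> C)) i = _).
      exact: l2_term_leD.
    by rewrite /l2_term !fctE rmorphN mulrNN.
  apply: (@le_trans _ _ (2 * ((2 * d) ^+ 2 + (2 * d) ^+ 2))).
    rewrite -mulr_sumr ler_pM2l// big_split/= lerD//; apply: tailC => //.
      by move=> i; rewrite !inE => /andP[].
    by move=> i; rewrite !inE => /andP[].
  rewrite -subr_ge0 [_ - _](_ : _ = 5 * d ^+ 2); last by ring.
  by rewrite mulr_ge0.
rewrite (le_lt_trans le5)// -subr_gt0 [_ - _](_ : _ = 3 * d); last by rewrite /d; field.
by rewrite mulr_gt0.
Qed.
End L2Compact.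

(** * Bounded operators and adjoints *)

Section BoundedMaps.
Variables (R : realType) (I : choiceType) (w : weight R I).
Local Notation C := R[i].
Implicit Types (f g : I -> C) (Phi Psi : (I -> C) -> (I -> C)).

(** [K] bounds the square of the operator norm. Bounds on finite partial sums replace the norm
    because [Phi] acts on all families, inside [E] or not. *)
Definition bounded_map Phi := exists2 K : C, 0 <= K & forall f M,
  (forall A : {fset I}, \sum_(i <- A) l2_term w f f i <= M) ->
  (forall A : {fset I}, \sum_(i <- A) l2_term w (Phi f) (Phi f) i <= K * M).

Lemma bounded_map_summable Phi f :
  bounded_map Phi -> square_summable w f -> square_summable w (Phi f).
Proof. by move=> [K _ PhiK] [M fM]; exists (K * M); exact: PhiK. Qed.

Lemma bounded_map_comp Phi Psi :
  bounded_map Phi -> bounded_map Psi -> bounded_map (Phi \o Psi).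
Proof.
move=> [K K0 PhiK] [L L0 PsiL]; exists (K * L); first exact: mulr_ge0.
by move=> f M fM; rewrite -mulrA; apply/PhiK/PsiL.
Qed.

Lemma bounded_mapD Phi Psi :
  bounded_map Phi -> bounded_map Psi -> bounded_map (fun f => Phi f + Psi f).
Proof.
move=> [K K0 PhiK] [L L0 PsiL]; exists (2 * (K + L)).
  by rewrite mulr_ge0// addr_ge0.
move=> f M fM A; apply: le_trans (ler_sum _ (fun i _ => l2_term_leD w _ _ i)) _.
by rewrite -mulr_sumr -mulrA ler_pM2l// big_split/= mulrDl lerD ?PhiK ?PsiL.
Qed.

Lemma bounded_mapN Phi : bounded_map Phi -> bounded_map (fun f => - Phi f).
Proof.
move=> [K K0 PhiK]; exists K => // f M fM A.
rewrite (eq_bigr (l2_term w (Phi f) (Phi f))) ?PhiK// => i _.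
by rewrite /l2_term !fctE rmorphN mulrNN.
Qed.

Lemma bounded_map0 : bounded_map (fun=> 0).
Proof.
exists 0 => // f M _ A; rewrite mul0r big1// => i _.
by rewrite /l2_term mul0r mulr0.
Qed.

Lemma bounded_map_sum (J : Type) (r : seq J) (Phi : J -> (I -> C) -> I -> C) :
  (forall j, bounded_map (Phi j)) -> bounded_map (fun f => \sum_(j <- r) Phi j f).
Proof.
move=> bP; elim: r => [|j r IH].
  by under eq_fun do rewrite big_nil; exact: bounded_map0.
by under eq_fun do rewrite big_cons; exact: bounded_mapD.
Qed.

Definition adjoint_maps Phi Psi := forall f g,
  square_summable w f -> square_summable w g ->
  coef_inner w (Phi f) g = coef_inner w f (Psi g).

Lemma coef_innerDl f g h : square_summable w f -> square_summable w g ->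
  square_summable w h ->
  coef_inner w (f + g) h = coef_inner w f h + coef_inner w g h.
Proof.
by move=> *; rewrite -[f in LHS]scale1r coef_inner_linearl// mul1r.
Qed.

Lemma square_summableD f g : square_summable w f -> square_summable w g ->
  square_summable w (f + g).
Proof. by move=> *; rewrite -[f]scale1r; exact: square_summable_linear. Qed.

Lemma coef_innerDr f g h : square_summable w f -> square_summable w g ->
  square_summable w h ->
  coef_inner w h (f + g) = coef_inner w h f + coef_inner w h g.
Proof.
move=> f2 g2 h2; rewrite coef_innerC//; last exact: square_summableD.
by rewrite coef_innerDl// rmorphD/= -!coef_innerC.
Qed.

Lemma adjoint_maps_sym Phi Psi : bounded_map Phi -> bounded_map Psi ->
  adjoint_maps Phi Psi -> adjoint_maps Psi Phi.
Proof.
move=> bPhi bPsi PP f g f2 g2.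
have := bounded_map_summable bPhi g2; have := bounded_map_summable bPsi f2.
by move=> Pf2 Pg2; rewrite coef_innerC// -PP// -coef_innerC.
Qed.

Lemma adjoint_maps_comp Phi Phi' Psi Psi' : bounded_map Phi' -> bounded_map Psi ->
  adjoint_maps Phi Psi -> adjoint_maps Phi' Psi' ->
  adjoint_maps (Phi \o Phi') (Psi' \o Psi).
Proof.
move=> bP bP' PP PP' f g f2 g2 /=.
by rewrite PP ?PP' => //; exact: bounded_map_summable.
Qed.

Lemma coef_inner0r f : coef_inner w f 0 = 0.
Proof.
apply: coef_innerP => e e0; exists fset0 => B _.
by rewrite big1 ?subr0 ?normr0// => i _; rewrite /l2_term conjC0 !mulr0.
Qed.

Lemma coef_inner0l f : coef_inner w 0 f = 0.
Proof.
apply: coef_innerP => e e0; exists fset0 => B _.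
by rewrite big1 ?subr0 ?normr0// => i _; rewrite /l2_term mul0r !mulr0.
Qed.

Lemma adjoint_maps_sum (J : Type) (r : seq J)
    (Phi Psi : J -> (I -> C) -> I -> C) :
  (forall j, bounded_map (Phi j)) -> (forall j, bounded_map (Psi j)) ->
  (forall j, adjoint_maps (Phi j) (Psi j)) ->
  adjoint_maps (fun f => \sum_(j <- r) Phi j f) (fun f => \sum_(j <- r) Psi j f).
Proof.
move=> bPhi bPsi PP f g f2 g2; elim: r => [|j r IH].
  by rewrite !big_nil coef_inner0l coef_inner0r.
have sPhi := bounded_map_summable (bounded_map_sum r bPhi) f2.
have sPsi := bounded_map_summable (bounded_map_sum r bPsi) g2.
rewrite !big_cons coef_innerDl ?coef_innerDr ?PP ?IH => //;
  exact: bounded_map_summable.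
Qed.

End BoundedMaps.

Section L2Operator.
Variables (R : realType) (I : choiceType) (w : weight R I) (E : coef_space R I).
Local Notation C := R[i].
Local Notation H := (l2_space w E).
Variable Phi : (I -> C) -> I -> C.
Hypothesis Phi_linear : linear Phi.
Hypothesis Phi_bounded : bounded_map w Phi.
Hypothesis Phi_E : forall f, f \in E -> Phi f \in E.

Lemma l2_map_subproof (u : H) : Phi u \in l2_pred w E.
Proof.
rewrite inE Phi_E ?l2_in_coef//=; apply/asboolP.
exact/bounded_map_summable/l2_square_summable.
Qed.

Definition l2_map (u : H) : H := L2Space (l2_map_subproof u).

Lemma l2_map_linear : linear l2_map.
Proof. by move=> k u v; apply/val_inj; exact: Phi_linear. Qed.

HB.instance Definition _ := GRing.isLinear.Build C H H *:%R l2_map l2_map_linear.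

Lemma l2_map_continuous : continuous l2_map.
Proof.
have [K K0 PhiK] := Phi_bounded => u.
have sK : 0 <= sqrtC K by rewrite sqrtC_ge0.
have leK v : `|l2_map v| <= sqrtC K * `|v|.
  apply: l2_norm_ub => [|A]; first by rewrite mulr_ge0 ?normr_ge0.
  by rewrite exprMn sqrtCK; apply: PhiK; exact: l2_sum_le_norm.
apply/(@cvgrPdist_lt C H H (nbhs u) (nbhs_filter u)) => e e0.
have e1 : 0 < e / (sqrtC K + 1) by rewrite divr_gt0// ltr_wpDl.
have := (@cvgrPdist_lt C H H (nbhs u) (nbhs_filter u) id u).1 (@cvg_id _ _) _ e1.
apply: filterS => v uv; rewrite -linearB.
apply: le_lt_trans (leK _) _.
apply: (@le_lt_trans _ _ ((sqrtC K + 1) * `|u - v|)).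
  by rewrite ler_wpM2r ?normr_ge0// lerDl.
by rewrite mulrC -ltr_pdivlMr// ltr_wpDl.
Qed.

Definition l2_operator : bounded_operator (l2_hilbert w E) :=
  @BoundedOperator R (l2_hilbert w E) l2_map l2_map_continuous.

End L2Operator.

(** The witness [S] rules out the default of [xget], and two adjoints differ at [y] by a vector
    orthogonal to itself. *)
Lemma adjointE (R : realType) (H : hilbertType R) (T : bounded_operator H)
    (S : H -> H) :
  (forall x y, inner H (T x) y = inner H x (S y)) -> adjoint T = S.
Proof.
move=> TS.
have adjP : forall x y, inner H (T x) y = inner H x (adjoint T y).
  exact: (xgetPex (fun=> 0) (P := [set S' : H -> H | forall x y,
    inner H (T x) y = inner H x (S' y)]) (ex_intro _ S TS)).
apply/funext => y; apply/eqP; rewrite -subr_eq0 -(dnorm_eq0 (inner H)).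
by rewrite linearBr/= -adjP -TS subrr.
Qed.

(** * Diagonal operators *)

Section Diagonal.
Variables (R : realType) (I : choiceType) (w : weight R I) (E : coef_space R I).
Local Notation C := R[i].
Local Notation H := (l2_hilbert w E).

(** Bessel's inequality for evaluation at [i]: the vector [v] below has [v i] and squared norm both
    equal to [S], so [l2_coord_le] reads [w i * S^2 <= S]. *)
Lemma l2_bessel (n : nat) (e : 'I_n -> H) (i : I) : orthonormal_family e ->
  \sum_(k < n) l2_term w (e k : l2_space w E) (e k : l2_space w E) i <= 1.
Proof.
move=> orth.
pose S := \sum_(k < n) `|(e k : l2_space w E) i| ^+ 2.
have -> : \sum_(k < n) l2_term w (e k : l2_space w E) (e k : l2_space w E) i
    = (w i)%:C * S.
  by rewrite mulr_sumr; apply: eq_bigr => k _; rewrite normCK.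
have S0 : 0 <= S by rewrite sumr_ge0// => k _; rewrite exprn_ge0.
pose v : H := \sum_(k < n) conjC ((e k : l2_space w E) i) *: e k.
have vi : (v : l2_space w E) i = S.
  rewrite /v /S; elim/big_rec2 : _ => // k x y _ <-.
  by rewrite normCK mulrC.
have vv : inner H v v = S.
  have ev k : inner H (e k) v = (e k : l2_space w E) i.
    rewrite /v linear_sumr (bigD1 k)//= big1 ?addr0.
      by rewrite linearZr_LR/= conjCK orth eqxx mulr1.
    move=> l lk; rewrite linearZr_LR/= orth eq_sym (negPf lk) mulr0//.
  rewrite {1}/v linear_sumlz; apply: eq_bigr => k _.
  by rewrite linearZl_LR/= ev normCK mulrC.
have := l2_coord_le (v : l2_space w E) i; rewrite vi.
rewrite [l2_inner _ _]vv ger0_norm// => wS.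
have [->|S1] := eqVneq S 0; first by rewrite mulr0.
have {}S0 : 0 < S by rewrite lt_def S1.
by rewrite -(ler_pM2r S0) mul1r -mulrA -expr2.
Qed.

Variables (mu : I -> R) (T : bounded_operator H).
Hypothesis TE : forall (u : l2_space w E) i,
  (T u : l2_space w E) i = (mu i)%:C * u i.

Lemma diagonal_adjoint : adjoint T = T.
Proof.
apply: adjointE => x y.
rewrite [LHS](_ : _ = coef_inner w (T x : l2_space w E) (y : l2_space w E))//.
rewrite [RHS](_ : _ = coef_inner w (x : l2_space w E) (T y : l2_space w E))//.
rewrite /coef_inner.
rewrite (_ : l2_term _ _ _ = l2_term w (x : l2_space w E) (T y : l2_space w E))//.
apply/funext => i; rewrite /l2_term !TE rmorphM/= [conjC (mu i)%:C]conj_Creal ?complex_real//.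
by ring.
Qed.

Lemma diagonal_term (u : l2_space w E) i :
  l2_term w (T u : l2_space w E) (T u : l2_space w E) i =
  (mu i ^+ 2)%:C * l2_term w u u i.
Proof.
rewrite /l2_term TE rmorphM/= [conjC (mu i)%:C]conj_Creal ?complex_real// rmorphXn/=.
by ring.
Qed.

Lemma diagonal_compact : (forall i, `|mu i| <= 1) ->
  (forall e, 0 < e -> exists A : {fset I}, forall i, i \notin A -> `|mu i| <= e) ->
  compact_operator T.
Proof.
move=> mu1 mu0.
have sq_le i (e : R) : `|mu i| <= e -> mu i ^+ 2 <= e ^+ 2.
  move=> le; rewrite -real_normK ?num_real// ler_sqr ?nnegrE//.
  exact: le_trans le.
apply: (@l2_precompact _ _ _ _ _ 1) => [_ [x /= x1 <-]|e e0].
  apply: l2_norm_ub => // A.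
  apply: (@le_trans _ _ (\sum_(i <- A)
      l2_term w (x : l2_space w E) (x : l2_space w E) i)).
    apply: ler_sum => i _; rewrite diagonal_term ler_piMl ?l2_term_ge0//.
    by rewrite lecR (le_trans (sq_le _ _ (mu1 i)))// expr1n.
  apply: le_trans (l2_sum_le_norm (x : l2_space w E) A) _.
  by rewrite ler_sqr ?nnegrE ?normr_ge0.
have eE : (complex.Re e)%:C = e by rewrite RRe_real// gtr0_real.
have [|A AP] := mu0 (complex.Re e); first by rewrite -ltcR eE.
exists A => _ [x /= x1 <-] B BA.
apply: (@le_trans _ _ (\sum_(i <- B)
    e ^+ 2 * l2_term w (x : l2_space w E) (x : l2_space w E) i)).
  rewrite big_seq [leRHS]big_seq; apply: ler_sum => i iB.
  rewrite diagonal_term ler_wpM2r ?l2_term_ge0// -eE -rmorphXn lecR.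
  exact/sq_le/AP/BA.
rewrite -mulr_sumr ler_piMr ?exprn_ge0 ?(ltW e0)//.
apply: le_trans (l2_sum_le_norm (x : l2_space w E) B) _.
by rewrite -(expr1n _ 2) ler_sqr ?nnegrE ?normr_ge0.
Qed.

(** An eigenvector for [s k ^+ 2] lives on the coordinates with [|mu i| = s k], so the power of
    [s k] is an average of powers of [|mu i|] with weights [t k i]. After exchanging the sums,
    [l2_bessel] bounds the total weight at each [i] by 1. *)
Lemma diagonal_singular_values (p M : R) : 0 < p ->
  (forall A : {fset I}, \sum_(i <- A) `|mu i| `^ p <= M) ->
  forall (n : nat) (s : 'I_n -> R),
    singular_values T s -> \sum_(k < n) s k `^ p <= 2 * M.
Proof.
move=> p0 muM n s [s0 [e orth es]].
pose t k i : R := complex.Re (l2_term w (e k : l2_space w E) (e k : l2_space w E) i).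
have tE k i : (t k i)%:C = l2_term w (e k : l2_space w E) (e k : l2_space w E) i.
  by rewrite RRe_real// ger0_real// l2_term_ge0.
have t0 k i : 0 <= t k i by rewrite -lecR tE l2_term_ge0.
have tmu k i : s k `^ p * t k i = `|mu i| `^ p * t k i.
  have [eki|eki] := eqVneq ((e k : l2_space w E) i) 0.
    by rewrite /t /l2_term eki mul0r mulr0/= !mulr0.
  congr (_ `^ _ * _).
  have := congr1 (fun u : l2_space w E => u i) (es k).
  rewrite /= diagonal_adjoint !TE mulrA -rmorphM/=.
  rewrite [RHS](_ : _ = (s k ^+ 2)%:C * (e k : l2_space w E) i)//.
  move=> /(mulIf eki)/complexI; rewrite -expr2 => /(congr1 Num.sqrt).
  by rewrite !sqrtr_sqr (ger0_norm (s0 k)).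
(* Finite sets carrying half the mass of each [e k] keep all sums finite; this is the origin of the
   factor 2 in the conclusion. *)
have half k : exists A : {fset I}, 2^-1 <= \sum_(i <- A) t k i.
  have := has_sum_inner (e k : l2_space w E) (e k : l2_space w E).
  rewrite [l2_inner _ _](orth k k) eqxx mulr1n => /(_ 2^-1)[]; first by rewrite invr_gt0.
  move=> A /(_ A (fsubset_refl A)) hA; exists A.
  rewrite -lecR rmorph_sum/= (eq_bigr _ (fun i _ => tE k i)).
  have S1 : \sum_(i <- A) l2_term w (e k : l2_space w E) (e k : l2_space w E) i <= 1.
    apply: le_trans (l2_sum_le_norm (e k : l2_space w E) A) _.
    by rewrite -l2_inner_norm [l2_inner _ _](orth k k) eqxx.
  move: hA; rewrite ger0_norm ?subr_ge0// ltrBlDr -ltrBlDl => /ltW.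
  by apply: le_trans; rewrite fmorphV rmorph_nat -subr_ge0 [_ - _](_ : _ = 0)//; field.
have [A AP] := choice half.
pose B := (\bigcup_(k <- enum 'I_n) A k)%fset.
have hB k : 2^-1 <= \sum_(i <- B) t k i.
  apply: le_trans (AP k) _; rewrite -lecR !rmorph_sum.
  apply: ler_sum_fsubset => [i|]; first by rewrite lecR.
  by apply: bigfcup_sup => //; rewrite mem_enum.
have le1 k : s k `^ p <= 2 * \sum_(i <- B) `|mu i| `^ p * t k i.
  rewrite -(eq_bigr _ (fun i _ => tmu k i)) -mulr_sumr mulrCA.
  rewrite -[leLHS]mulr1 ler_wpM2l ?powR_ge0//.
  by rewrite -ler_pdivrMl// mulr1.
apply: le_trans (ler_sum _ (fun k _ => le1 k)) _.
rewrite -mulr_sumr ler_pM2l// exchange_big/=.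
apply: le_trans (muM B); apply: ler_sum => i _.
rewrite -mulr_sumr ler_piMr ?powR_ge0//.
rewrite -lecR rmorph_sum/= (eq_bigr _ (fun k _ => tE k i)).
exact: l2_bessel.
Qed.

End Diagonal.

(** * Polynomial operators and multiplication on the sphere *)

Section MultiIndex.
Variables (J : finType).
Local Notation mindex := {ffun J -> nat}.
Implicit Types (g : mindex) (s t : J).

Definition incr s g : mindex := [ffun t => (g t + (t == s))%N].
(** The subtraction is truncated, so [decr s] fixes [g] when [g s = 0]; hence the case distinction
    in [mulx]. *)
Definition decr s g : mindex := [ffun t => (g t - (t == s))%N].

Lemma incrK s : cancel (incr s) (decr s).
Proof. by move=> g; apply/ffunP => t; rewrite !ffunE addnK. Qed.

Lemma decrK s g : g s != 0%N -> incr s (decr s g) = g.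
Proof.
move=> gs; apply/ffunP => t; rewrite !ffunE subnK//.
by have [->|] := eqVneq t s; rewrite ?lt0n.
Qed.

Lemma incrC s t g : incr s (incr t g) = incr t (incr s g).
Proof. by apply/ffunP => r; rewrite !ffunE addnAC. Qed.

Lemma decrC s t g : decr s (decr t g) = decr t (decr s g).
Proof. by apply/ffunP => r; rewrite !ffunE subnAC. Qed.

Lemma decr_incr s t g : s != t -> decr t (incr s g) = incr s (decr t g).
Proof.
move=> st; apply/ffunP => r; rewrite !ffunE.
have [->|rt] := eqVneq r t; last by rewrite !subn0.
by rewrite eq_sym (negPf st) !addn0.
Qed.

End MultiIndex.

Section PolynomialOperators.
Variables (R : realType) (J : finType).
Local Notation C := R[i].
Local Notation mindex := {ffun J -> nat}.
Implicit Types (f : mindex -> C) (g : mindex) (s t : J) (phi : mindex -> C).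

(** A family [f] is the formal power series with coefficient [f g] at the monomial of exponent [g].
    In this reading [mulx s] multiplies by the variable [s], and [der s] is the partial
    derivative. *)
Definition mulx s f : mindex -> C :=
  fun g => if g s == 0%N then 0 else f (decr s g).
Definition der s f : mindex -> C := fun g => (g s).+1%:R * f (incr s g).
Definition diag phi f : mindex -> C := fun g => phi g * f g.

Lemma mulx_linear s : linear (mulx s).
Proof.
move=> k f h; apply/funext => g.
change ((if g s == 0%N then 0 else k * f (decr s g) + h (decr s g)) =
  k * (if g s == 0%N then 0 else f (decr s g)) +
  (if g s == 0%N then 0 else h (decr s g))).
by case: ifP => _; rewrite ?mulr0 ?addr0.
Qed.
HB.instance Definition _ s := GRing.isLinear.Build C (mindex -> C) (mindex -> C)
  *:%R (mulx s) (mulx_linear s).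

Lemma der_linear s : linear (der s).
Proof.
move=> k f h; apply/funext => g.
change ((g s).+1%:R * (k * f (incr s g) + h (incr s g)) =
  k * ((g s).+1%:R * f (incr s g)) + (g s).+1%:R * h (incr s g)).
by ring.
Qed.
HB.instance Definition _ s := GRing.isLinear.Build C (mindex -> C) (mindex -> C)
  *:%R (der s) (der_linear s).

Lemma diag_linear phi : linear (diag phi).
Proof.
move=> k f h; apply/funext => g.
change (phi g * (k * f g + h g) = k * (phi g * f g) + phi g * h g).
by ring.
Qed.
HB.instance Definition _ phi := GRing.isLinear.Build C (mindex -> C) (mindex -> C)
  *:%R (diag phi) (diag_linear phi).

Lemma mulxD s : {morph mulx s : f h / f + h}. Proof. exact: linearD. Qed.
Lemma mulxB s : {morph mulx s : f h / f - h}. Proof. exact: linearB. Qed.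
Lemma mulxZ s k : {morph mulx s : f / k *: f}. Proof. exact: linearZ. Qed.
Lemma derD s : {morph der s : f h / f + h}. Proof. exact: linearD. Qed.
Lemma derB s : {morph der s : f h / f - h}. Proof. exact: linearB. Qed.
Lemma derZ s k : {morph der s : f / k *: f}. Proof. exact: linearZ. Qed.
Lemma diagD phi : {morph diag phi : f h / f + h}. Proof. exact: linearD. Qed.
Lemma diagB phi : {morph diag phi : f h / f - h}. Proof. exact: linearB. Qed.
Lemma diagZ phi k : {morph diag phi : f / k *: f}. Proof. exact: linearZ. Qed.

Definition linE := (mulxB, mulxD, mulxZ, derB, derD, derZ, diagB, diagD, diagZ).

Lemma mulxC s t f : mulx s (mulx t f) = mulx t (mulx s f).
Proof.
have [->//|st] := eqVneq s t; apply/funext => g; rewrite /mulx !ffunE.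
rewrite (eq_sym t) (negPf st) !subn0 decrC.
by do 2!case: ifP.
Qed.

Lemma derC s t f : der s (der t f) = der t (der s f).
Proof.
have [->//|st] := eqVneq s t; apply/funext => g; rewrite /der !ffunE.
by rewrite (eq_sym t) (negPf st) !addn0 incrC mulrCA.
Qed.

(** The canonical commutation relation; together with [der_diag] and [diag_mulx] it brings every
    composite to a form with the variables on the left. *)
Lemma der_mulx s t f : der s (mulx t f) = mulx t (der s f) + (s == t)%:R *: f.
Proof.
apply/funext => g.
change ((g s).+1%:R * (if incr s g t == 0%N then 0 else f (decr t (incr s g))) =
  (if g t == 0%N then 0 else (decr t g s).+1%:R * f (incr s (decr t g))) +
  (s == t)%:R * f g).
have [->|st] := eqVneq s t.
  rewrite !ffunE eqxx addn1 /= incrK mul1r.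
  have [gt|gt] := eqVneq (g t) 0%N; first by rewrite gt add0r mul1r.
  by rewrite decrK// subn1 prednK ?lt0n// -natr1 mulrDl mul1r.
rewrite mul0r addr0 !ffunE (eq_sym t) (negPf st) addn0 subn0.
by case: ifP => _; rewrite ?mulr0// decr_incr.
Qed.

Lemma der_diag s phi f : der s (diag phi f) = diag (phi \o incr s) (der s f).
Proof. by apply/funext => g; rewrite /der /diag/= mulrCA. Qed.

Lemma diag_mulx s phi f : diag phi (mulx s f) = mulx s (diag (phi \o incr s) f).
Proof.
apply/funext => g; rewrite /mulx /diag/=.
by case: (eqVneq (g s) 0%N) => gs; rewrite ?mulr0// decrK.
Qed.

Lemma mulx_der s f g : mulx s (der s f) g = (g s)%:R * f g.
Proof.
rewrite /mulx /der; case: eqVneq => [->|gs]; first by rewrite mul0r.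
by rewrite decrK// ffunE eqxx subn1 prednK ?lt0n.
Qed.

Lemma diagC phi psi f : diag phi (diag psi f) = diag psi (diag phi f).
Proof. by apply/funext => g; rewrite /diag mulrCA. Qed.

End PolynomialOperators.

(** * Harmonic families and multiplication by the coordinates of the sphere *)

Section Sphere.
Variables (R : realType) (m : nat).
Local Notation C := R[i].
Local Notation J := ('I_m * bool)%type.
Local Notation mindex := {ffun J -> nat}.
Implicit Types (f h : mindex -> C) (g : mindex) (s t : J).

Definition cbar s : J := (s.1, ~~ s.2).
Definition bidegree (b : bool) g : nat := \sum_(i < m) g (i, b).
Definition degree g : nat := (bidegree true g + bidegree false g)%N.
(** The index [k] counts the degree shifts that arise when [kappa 0] is moved past variables and
    derivatives. *)
Definition kappa (k : nat) g : C := ((m + degree g + k)%N%:R)^-1.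
(** [rho] is multiplication by [|z|^2], and [laplacian] is one quarter of the Euclidean
    Laplacian. *)
Definition rho f := \sum_(i < m) mulx (i, true) (mulx (i, false) f).
Definition laplacian f := \sum_(i < m) der (i, true) (der (i, false) f).
Definition lower s f := diag (kappa 0) (der (cbar s) f).
(* The variable (i, true) is z_i and (i, false) is its conjugate.  For harmonic f
   the components of x_s f on the sphere, where rho = 1, are lower s f and
   x_s f - rho (lower s f). *)
Definition mulz s f := mulx s f + lower s f - rho (lower s f).

Lemma cbarK s : cbar (cbar s) = s.
Proof. by case: s => i []. Qed.

Lemma bidegree_incr b s g : bidegree b (incr s g) = (bidegree b g + (s.2 == b))%N.
Proof.
rewrite /bidegree; under eq_bigr do rewrite ffunE.
rewrite big_split/=; congr (_ + _)%N; case: s => i c /=.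
rewrite (bigD1 i)//= big1 ?addn0; first by rewrite xpair_eqE eqxx/= eq_sym.
by move=> j ji; rewrite xpair_eqE (negPf ji).
Qed.

Lemma degree_incr s g : degree (incr s g) = (degree g).+1.
Proof.
by rewrite /degree !bidegree_incr addnACA; case: s.2; rewrite addn1.
Qed.

Lemma kappa_incr k s : kappa k \o incr s = kappa k.+1.
Proof. by apply/funext => g; rewrite /= /kappa degree_incr !addnS. Qed.

Lemma rho_linear : linear rho.
Proof.
move=> k f h; rewrite /rho scaler_sumr -big_split.
by apply: eq_bigr => i _; rewrite !linearP.
Qed.
HB.instance Definition _ := GRing.isLinear.Build C (mindex -> C) (mindex -> C)
  *:%R rho rho_linear.

Lemma rhoD : {morph rho : f h / f + h}. Proof. exact: linearD. Qed.
Lemma rhoB : {morph rho : f h / f - h}. Proof. exact: linearB. Qed.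

Lemma laplacian_linear : linear laplacian.
Proof.
move=> k f h; rewrite /laplacian scaler_sumr -big_split.
by apply: eq_bigr => i _; rewrite !linearP.
Qed.
HB.instance Definition _ := GRing.isLinear.Build C (mindex -> C) (mindex -> C)
  *:%R laplacian laplacian_linear.

Lemma laplacianD : {morph laplacian : f h / f + h}. Proof. exact: linearD. Qed.
Lemma laplacianB : {morph laplacian : f h / f - h}. Proof. exact: linearB. Qed.

Lemma rho_mulx s f : rho (mulx s f) = mulx s (rho f).
Proof.
rewrite /rho linear_sum/=; apply: eq_bigr => i _.
by rewrite (mulxC (i, false)) (mulxC (i, true)).
Qed.

Lemma der_rho s f : der s (rho f) = rho (der s f) + mulx (cbar s) f.
Proof.
rewrite /rho linear_sum/=.
under eq_bigr => i _ do rewrite der_mulx der_mulx mulxD mulxZ -addrA.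
rewrite big_split/=; congr (_ + _); case: s => j c; rewrite /cbar/=.
rewrite (bigD1 j)//= big1 ?addr0.
  rewrite !xpair_eqE eqxx/=; case: c => /=.
    by rewrite scale0r scale1r add0r.
  by rewrite scale0r scale1r addr0.
by move=> i ij; rewrite !xpair_eqE (eq_sym j) (negPf ij) /= !scale0r addr0.
Qed.

Lemma diag_rho phi psi f :
  (forall i g, phi (incr (i, true) (incr (i, false) g)) = psi g) ->
  diag phi (rho f) = rho (diag psi f).
Proof.
move=> pp; rewrite /rho linear_sum/=; apply: eq_bigr => i _.
rewrite !diag_mulx; congr (mulx _ (mulx _ (diag _ f))).
by apply/funext => g; exact: pp.
Qed.

Lemma kappa_rho k f : diag (kappa k) (rho f) = rho (diag (kappa k.+2) f).
Proof. by apply: diag_rho => i g; rewrite /kappa !degree_incr !addnS. Qed.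

Lemma kappa_mulx k s f : diag (kappa k) (mulx s f) = mulx s (diag (kappa k.+1) f).
Proof. by rewrite diag_mulx kappa_incr. Qed.

Lemma der_kappa k s f : der s (diag (kappa k) f) = diag (kappa k.+1) (der s f).
Proof. by rewrite der_diag kappa_incr. Qed.

Hypothesis m_gt0 : (0 < m)%N.

(** This is [1/x - 1/(x (x + 1)) = 1/(x + 1)]; it makes the two mixed terms of [mulz_mulz] symmetric
    in [s] and [t]. *)
Lemma kappaB k f :
  diag (kappa k) f - diag (kappa k.+1) (diag (kappa k) f) = diag (kappa k.+1) f.
Proof.
apply/funext => g; rewrite !fctE /diag mulrA -mulrBl; congr (_ * _).
have n0 j : (m + degree g + j)%N%:R != 0 :> C.
  by rewrite pnatr_eq0 -lt0n !addn_gt0 m_gt0.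
move: (n0 k) (n0 k.+1); rewrite /kappa addnS -natr1.
by move: (_%:R) => x x0 x1; field; rewrite x0 x1.
Qed.

(** A normal form whose symmetry in [s] and [t] gives commutativity. On the sphere [rho] is 1, so
    [h - rho h] vanishes there and the product [x_s x_t f] remains. *)
Lemma mulz_mulz s t f : mulz s (mulz t f) = mulx s (mulx t f) +
  let h := mulx s (diag (kappa 1) (der (cbar t) f)) +
    mulx t (diag (kappa 1) (der (cbar s) f)) + (cbar s == t)%:R *: diag (kappa 0) f +
    diag (kappa 0) (diag (kappa 1) (der (cbar s) (der (cbar t) f))) -
    rho (diag (kappa 2) (diag (kappa 1) (der (cbar s) (der (cbar t) f)))) in
  h - rho h.
Proof.
rewrite {1}/mulz -addrA; rewrite [in mulx s _]/mulz.
have -> : lower s (mulz t f) = mulx s (diag (kappa 1) (der (cbar t) f)) +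
    mulx t (diag (kappa 1) (der (cbar s) f)) + (cbar s == t)%:R *: diag (kappa 0) f +
    diag (kappa 0) (diag (kappa 1) (der (cbar s) (der (cbar t) f))) -
    rho (diag (kappa 2) (diag (kappa 1) (der (cbar s) (der (cbar t) f)))) -
    mulx s (diag (kappa 0) (der (cbar t) f)).
  rewrite /mulz /lower !linE der_mulx der_rho cbarK der_kappa.
  rewrite !linE kappa_rho !kappa_mulx.
  rewrite -[in RHS](kappaB 0 (der (cbar t) f)) mulxB.
  apply/funext => g; rewrite !fctE. by ring.
rewrite /lower !(linE, rhoB, rhoD) !rho_mulx.
by apply/funext => g; rewrite !fctE; ring.
Qed.

Lemma mulzC s t f : mulz s (mulz t f) = mulz t (mulz s f).
Proof.
rewrite !mulz_mulz mulxC derC (addrC (mulx t (diag _ _))).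
by rewrite (_ : (cbar s == t) = (cbar t == s))// (can2_eq cbarK cbarK) eq_sym.
Qed.

Lemma euler b f :
  \sum_(i < m) mulx (i, b) (der (i, b) f) = diag (fun g => (bidegree b g)%:R) f.
Proof.
apply/funext => g; rewrite fct_sumE /diag /bidegree natr_sum mulr_suml.
by apply: eq_bigr => i _; rewrite mulx_der.
Qed.

Lemma laplacian_der s f : laplacian (der s f) = der s (laplacian f).
Proof.
rewrite /laplacian linear_sum/=; apply: eq_bigr => i _.
by rewrite (derC (i, false)) (derC (i, true)).
Qed.

Lemma laplacian_diag phi psi f :
  (forall i g, phi (incr (i, false) (incr (i, true) g)) = psi g) ->
  laplacian (diag phi f) = diag psi (laplacian f).
Proof.
move=> pp; rewrite /laplacian linear_sum/=; apply: eq_bigr => i _.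
rewrite !der_diag; congr diag; apply/funext => g; exact: pp.
Qed.

Lemma laplacian_mulx s f :
  laplacian (mulx s f) = mulx s (laplacian f) + der (cbar s) f.
Proof.
rewrite /laplacian linear_sum/=.
under eq_bigr => i _ do rewrite der_mulx derD derZ der_mulx -addrA.
rewrite big_split/=; congr (_ + _); case: s => j c; rewrite /cbar/=.
rewrite (bigD1 j)//= big1 ?addr0.
  rewrite !xpair_eqE eqxx/=; case: c => /=.
    by rewrite scale0r scale1r addr0.
  by rewrite scale0r scale1r add0r.
by move=> i ij; rewrite !xpair_eqE (negPf ij) /= !scale0r addr0.
Qed.

(** Moving the two derivatives of index [i] past [rho] leaves [f] plus the two Euler terms of that
    index; summing over [i] gives [m] plus the degree. *)
Lemma laplacian_rho f : laplacian f = 0 ->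
  laplacian (rho f) = diag (fun g => (m + degree g)%:R) f.
Proof.
move=> hf; rewrite {1}/laplacian.
transitivity (rho (laplacian f) + \sum_(i < m) (f +
    (mulx (i, true) (der (i, true) f) + mulx (i, false) (der (i, false) f)))).
  rewrite /laplacian linear_sum -big_split/=; apply: eq_bigr => i _.
  rewrite der_rho derD der_rho /cbar/= der_mulx eqxx scale1r.
  by apply/funext => g; rewrite !fctE; ring.
rewrite hf linear0 add0r !big_split/= !euler.
apply/funext => g; rewrite [LHS](_ : _ = (\sum_(i < m) f) g +
  ((bidegree true g)%:R * f g + (bidegree false g)%:R * f g))//.
rewrite fct_sumE sumr_const card_ord /diag /degree !natrD -mulr_natl.
by ring.
Qed.

Definition harmonic f := laplacian f = 0.

Lemma harmonic_lower s f : harmonic f -> harmonic (lower s f).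
Proof.
move=> hf; rewrite /harmonic /lower.
rewrite (@laplacian_diag _ (kappa 2)) ?laplacian_der ?hf ?linear0//.
by move=> i g; rewrite /kappa !degree_incr !addnS.
Qed.

(** The Laplacian of [mulx s f] is [der (cbar s) f], and by [laplacian_rho] that of
    [rho (lower s f)] is the same, [kappa 0] being the inverse of the factor that appears. *)
Lemma harmonic_mulz s f : harmonic f -> harmonic (mulz s f).
Proof.
move=> hf; have hl : laplacian (lower s f) = 0 := harmonic_lower s hf.
rewrite /harmonic /mulz laplacianB laplacianD laplacian_mulx hf linear0 add0r.
rewrite laplacian_rho// hl addr0.
apply/eqP; rewrite subr_eq0; apply/eqP/funext => g.
rewrite /lower /diag /kappa addn0 mulrA divff ?mul1r//.
by rewrite pnatr_eq0 -lt0n addn_gt0 m_gt0.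
Qed.

Lemma rhoE b f : \sum_(i < m) mulx (i, ~~ b) (mulx (i, b) f) = rho f.
Proof. by rewrite /rho; case: b => //=; apply: eq_bigr => i _; rewrite mulxC. Qed.

Lemma laplacianE b f : \sum_(i < m) der (i, b) (der (i, ~~ b) f) = laplacian f.
Proof.
by rewrite /laplacian; case: b => //=; apply: eq_bigr => i _; rewrite derC.
Qed.

Lemma degreeE b g : (bidegree (~~ b) g + bidegree b g)%N = degree g.
Proof. by rewrite /degree; case: b => //=; rewrite addnC. Qed.

(** The relation [|z|^2 = 1] on the sphere. In the sum of the normal forms the second derivatives
    add up to the Laplacian, while the Euler terms and the [m] commutators give [m + degree], which
    cancels [kappa 0]. *)
Lemma sum_mulz_mulz b f : harmonic f ->
  \sum_(i < m) mulz (i, ~~ b) (mulz (i, b) f) = f.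
Proof.
move=> hf.
pose G i := diag (kappa 1) (der (i, b) (der (i, ~~ b) f)).
have GE : \sum_(i < m) G i = 0.
  by rewrite -linear_sum laplacianE hf linear0.
pose hh i := mulx (i, ~~ b) (diag (kappa 1) (der (i, ~~ b) f)) +
    mulx (i, b) (diag (kappa 1) (der (i, b) f)) + diag (kappa 0) f +
    diag (kappa 0) (G i) - rho (diag (kappa 2) (G i)).
have hhE : \sum_(i < m) hh i = f.
  have s1 : \sum_(i < m) diag (kappa 0) (G i) = 0.
    by rewrite -linear_sum GE linear0.
  have s2 : \sum_(i < m) rho (diag (kappa 2) (G i)) = 0.
    rewrite -linear_sum (_ : \sum_(i < m) _ = 0) ?linear0//.
    by rewrite -linear_sum GE linear0.
  have s3 c : \sum_(i < m) mulx (i, c) (diag (kappa 1) (der (i, c) f)) =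
      diag (kappa 0) (diag (fun g => (bidegree c g)%:R) f).
    by rewrite -euler linear_sum/=; apply: eq_bigr => i _; rewrite kappa_mulx.
  have s4 : \sum_(i < m) diag (kappa 0) f = diag (kappa 0) (\sum_(i < m) f).
    by rewrite linear_sum.
  rewrite /hh sumrB !big_split/= s1 s2 !s3 s4 subr0 addr0 -!diagD.
  apply/funext => g; rewrite /diag [X in _ * X](_ : _ =
    (bidegree (~~ b) g)%:R * f g + (bidegree b g)%:R * f g + (\sum_(i < m) f) g)//.
  rewrite fct_sumE sumr_const card_ord -[f g *+ m]mulr_natl.
  rewrite -!mulrDl -!natrD degreeE mulrA.
  rewrite /kappa addn0 [(degree g + m)%N]addnC mulVf ?mul1r//.
  by rewrite pnatr_eq0 -lt0n addn_gt0 m_gt0.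
transitivity (\sum_(i < m) mulx (i, ~~ b) (mulx (i, b) f) +
    (\sum_(i < m) hh i - rho (\sum_(i < m) hh i))).
  have -> : rho (\sum_(i < m) hh i) = \sum_(i < m) rho (hh i) by exact: linear_sum.
  rewrite -sumrB -big_split/=; apply: eq_bigr => i _.
  by rewrite mulz_mulz /cbar/= negbK eqxx scale1r.
by rewrite hhE rhoE addrC subrK.
Qed.

End Sphere.

(** * Bidegree multipliers between two coordinate multiplications *)

Section Multiplier.
Variables (R : realType) (m : nat).
Local Notation C := R[i].
Local Notation kappa := (@kappa R m).
Local Notation mindex := {ffun 'I_m * bool -> nat}.
Implicit Types (f : mindex -> C) (g : mindex).
Hypothesis m_gt0 : (0 < m)%N.
Variables (mu : nat -> nat -> C) (c : bool).
(** The shifts [q] and [r] count the variables of each type already passed. The flag [c] exchanges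
    the roles of [z] and its conjugate, so that both sums of the theorem are covered. *)
Let M (q r : nat) g : C :=
  mu (bidegree c g + q)%N (bidegree (~~ c) g + r)%N.

Lemma multiplier_incr i q r : M q r \o incr (i, c) = M q.+1 r.
Proof.
apply/funext => g; rewrite /M /= !bidegree_incr/= eqxx addn1 addSnnS.
by case: c; rewrite addn0.
Qed.

Lemma multiplier_incrN i q r : M q r \o incr (i, ~~ c) = M q r.+1.
Proof.
apply/funext => g; rewrite /M /= !bidegree_incr/= eqxx addn1 addSnnS.
by case: c; rewrite addn0.
Qed.

Lemma multiplier_rho q r f : diag (M q r) (rho f) = rho (diag (M q.+1 r.+1) f).
Proof.
by apply: diag_rho => i g; rewrite /M !bidegree_incr/=;
  case: c; rewrite /= !addn0 !addn1 !addSnnS.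
Qed.

Lemma harmonic_multiplier q r f : harmonic f -> harmonic (diag (M q r) f).
Proof.
move=> hf; rewrite /harmonic (laplacian_diag (psi := M q.+1 r.+1)) ?hf ?linear0//.
by move=> i g; rewrite /M !bidegree_incr/=; case: c;
  rewrite /= !addn0 !addn1 !addSnnS.
Qed.

(** The upper component of the product sees exactly [M 1 0]; the lower one has bidegree smaller by
    one in [~~ c], which leaves the defect [M 0 0 - M 1 1]. *)
Lemma multiplier_mulz i f : diag (M 0 0) (mulz (i, c) f) =
  mulz (i, c) (diag (M 1 0) f) +
  diag (kappa 0) (diag (M 0 0) (der (i, ~~ c) f) - diag (M 1 1) (der (i, ~~ c) f)).
Proof.
rewrite /mulz /lower /cbar/= !linE diag_mulx multiplier_incr multiplier_rho.
rewrite der_diag multiplier_incrN (diagC (M 0 0)) (diagC (M 1 1)).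
by apply/funext => g; rewrite !fctE; ring.
Qed.

(** The conditions on [mu] say that the eigenvalues vanish. By [multiplier_mulz] and [sum_mulz_mulz]
    the sum is [M 1 0] applied to [f] plus the contribution of the defects [h i], whose lower parts
    add up to Laplacians and whose upper parts are evaluated by [euler]. *)
Lemma sum_mulz_multiplier f : (forall a, mu a.+1 0 = 0) ->
  (forall a b, mu a.+1 b.+1 * ((m + a)%:R - 1) + b.+1%:R * mu a b = 0) ->
  harmonic f ->
  \sum_(i < m) mulz (i, ~~ c) (diag (M 0 0) (mulz (i, c) f)) = 0.
Proof.
move=> mu0 muS hf.
pose h i := diag (kappa 0)
  (diag (M 0 0) (der (i, ~~ c) f) - diag (M 1 1) (der (i, ~~ c) f)).
have diag0 phi : diag phi 0 = 0 :> (mindex -> C) by exact: linear0.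
have lower0 : \sum_(i < m) lower (i, ~~ c) (h i) = 0.
  transitivity (diag (kappa 0) (diag (kappa 1) (diag (M 1 0) (laplacian f) -
      diag (M 2 1) (laplacian f)))); last by rewrite hf !diag0 subr0 !diag0.
  rewrite -(laplacianE c).
  rewrite (linear_sum (diag (M 1 0))) (linear_sum (diag (M 2 1))) -sumrB.
  rewrite (linear_sum (diag (kappa 1))) (linear_sum (diag (kappa 0))).
  apply: eq_bigr => i _.
  by rewrite /lower /h /cbar/= negbK der_kappa derB !der_diag !multiplier_incr.
(* The predecessor at bidegree 0 is harmless, since [psi] is multiplied by that bidegree in
   [mulxE]. *)
pose psi g : C := ((m + degree g)%:R - 1)^-1 *
  (mu (bidegree c g) (bidegree (~~ c) g).-1 -
   mu (bidegree c g).+1 (bidegree (~~ c) g)).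
have mulxE : \sum_(i < m) mulx (i, ~~ c) (h i) =
    diag psi (diag (fun g => (bidegree (~~ c) g)%:R) f).
  rewrite -euler linear_sum/=; apply: eq_bigr => i _; rewrite diag_mulx.
  congr (mulx _); apply/funext => g; set d := der (i, ~~ c) f.
  change (kappa 0 g * (M 0 0 g * d g - M 1 1 g * d g) =
    psi (incr (i, ~~ c) g) * d g).
  rewrite /psi /M /kappa degree_incr [(m + _.+1)%N]addnS -natr1 addrK.
  rewrite !bidegree_incr/= eqxx.
  have -> : (~~ c == c) = false by case: c.
  by rewrite !addn0 !addn1 -mulrBl mulrA.
transitivity (diag (M 1 0) f +
    (\sum_(i < m) mulx (i, ~~ c) (h i) + \sum_(i < m) lower (i, ~~ c) (h i) -
    rho (\sum_(i < m) lower (i, ~~ c) (h i)))).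
  rewrite -[X in _ = X + _](sum_mulz_mulz m_gt0 c (harmonic_multiplier 1 0 hf)).
  have -> : rho (\sum_(i < m) lower (i, ~~ c) (h i)) =
    \sum_(i < m) rho (lower (i, ~~ c) (h i)) by exact: linear_sum.
  rewrite -big_split -sumrB -big_split/=; apply: eq_bigr => i _.
  rewrite multiplier_mulz -/(h i).
  have mulzD s : {morph mulz s : f1 f2 / f1 + f2 >-> f1 + f2}.
    move=> f1 f2; rewrite /mulz /lower !linE rhoD.
    by apply/funext => g; rewrite !fctE; ring.
  by rewrite mulzD {2}/mulz.
rewrite lower0 linear0 subr0 addr0 mulxE.
apply/funext => g.
change (M 1 0 g * f g + psi g * ((bidegree (~~ c) g)%:R * f g) = 0).
rewrite /psi /M addn0 addn1.
case E : (bidegree (~~ c) g) => [|b]; first by rewrite mu0 !mul0r mulr0 addr0.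
rewrite -(degreeE c) E.
have n0 : (m + bidegree c g + b)%:R != 0 :> C.
  by rewrite pnatr_eq0 -lt0n !addn_gt0 m_gt0.
have -> : (m + (b.+1 + bidegree c g))%:R - 1 = (m + bidegree c g + b)%:R :> C.
  by rewrite addSn addnS -natr1 addrK [(b + _)%N]addnC addnA.
rewrite /=; set x := mu _ _; set y := mu _ b.
have xy : x * ((m + bidegree c g)%:R - 1) + b.+1%:R * y = 0 by exact: muS.
rewrite (_ : _ + _ = (m + bidegree c g + b)%:R^-1 * f g *
  (x * ((m + bidegree c g)%:R - 1) + b.+1%:R * y)); first by rewrite xy mulr0.
by move: n0; rewrite -natr1 !natrD => n0; field.
Qed.

End Multiplier.

(** * The weighted l^2 norm of the sphere *)

Section SphereOperators.
Variables (R : realType) (m : nat).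
Local Notation C := R[i].
Local Notation J := ('I_m * bool)%type.
Local Notation mindex := {ffun J -> nat}.
Implicit Types (f h : mindex -> C) (g : mindex) (s t : J).
Local Notation kappa := (@kappa R m).
Hypothesis m_gt0 : (0 < m)%N.

(* Up to a constant, the squared norm in L^2 of the unit sphere of C^m of the
   monomials that occur in a harmonic polynomial (Fischer's formula). *)
Definition sphere_weight_fun g : R :=
  (\prod_t (g t)`!)%:R / (\prod_(k < degree g) (m + k))%N%:R.

Lemma sphere_weight_gt0 g : 0 < sphere_weight_fun g.
Proof.
rewrite divr_gt0// ltr0n prodn_gt0// => t; first by rewrite fact_gt0.
by rewrite addn_gt0 m_gt0.
Qed.

Definition sphere_weight : weight R mindex := Weight sphere_weight_gt0.

(** The quotient of consecutive weights, and also the factor in [lower] (see [lowerE]): this makes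
    [lower] the adjoint of a multiplication. *)
Definition shift_ratio s g : R := (g s).+1%:R / (m + degree g)%:R.

Lemma sphere_weight_incr s g :
  sphere_weight (incr s g) = sphere_weight g * shift_ratio s g.
Proof.
rewrite /sphere_weight /= /sphere_weight_fun /shift_ratio degree_incr big_ord_recr/=.
rewrite (bigD1 s)//= [in RHS](bigD1 s)//= ffunE eqxx addn1 factS.
rewrite (eq_bigr (fun t => (g t)`!)); last first.
  by move=> t /negPf ts; rewrite ffunE ts addn0.
have h1 : (m + degree g)%:R != 0 :> R by rewrite pnatr_eq0 -lt0n addn_gt0 m_gt0.
have h2 : (\prod_(k < degree g) (m + k))%N%:R != 0 :> R.
  by rewrite pnatr_eq0 -lt0n prodn_gt0// => k; rewrite addn_gt0 m_gt0.
rewrite !natrM; move: (_%:R) (_%:R) h1 h2 => x y x0 y0.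
by field; rewrite x0 y0.
Qed.

Lemma real_complexM (a b : R) : (a * b)%:C = a%:C * b%:C :> C.
Proof. exact: rmorphM. Qed.

Lemma coord_le_degree s g : (g s <= degree g)%N.
Proof.
have le b i : (g (i, b) <= bidegree b g)%N by rewrite /bidegree (bigD1 i)//= leq_addr.
case: s => i []; apply: leq_trans (le _ i) _; rewrite /degree ?leq_addr//.
exact: leq_addl.
Qed.

Lemma shift_ratio_ge0 s g : 0 <= shift_ratio s g.
Proof. by rewrite divr_ge0. Qed.

Lemma shift_ratio_le1 s g : shift_ratio s g <= 1.
Proof.
rewrite ler_pdivrMr ?mul1r ?ler_nat ?ltr0n ?addn_gt0 ?m_gt0//.
by rewrite -add1n leq_add// coord_le_degree.
Qed.

Lemma bounded_mulx s : bounded_map sphere_weight (mulx s : (mindex -> C) -> _).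
Proof.
exists 1 => // f M fM A; rewrite mul1r.
rewrite (big_fsetID _ (fun g => g s != 0%N))/= [X in _ + X]big1_fset ?addr0; last first.
  move=> g; rewrite !inE negbK => /andP[_ /eqP gs] _.
  by rewrite /l2_term /mulx gs eqxx mul0r mulr0.
set B := [fset g in A | _]%fset.
apply: le_trans (fM (decr s @` B)%fset).
rewrite [leRHS]big_imfset/=; last first.
  move=> g g'; rewrite !inE => /andP[_ gs] /andP[_ gs'] /(congr1 (incr s)).
  by rewrite !decrK.
rewrite big_seq [leRHS]big_seq; apply: ler_sum => g; rewrite !inE => /andP[_ gs].
rewrite /l2_term /mulx (negPf gs) ler_wpM2r ?mul_conjC_ge0// lecR.
rewrite -[in leLHS](decrK gs) sphere_weight_incr ler_piMr ?shift_ratio_le1//.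
exact/ltW/sphere_weight_gt0.
Qed.

Lemma lowerE s f g :
  lower s f g = (shift_ratio (cbar s) g)%:C * f (incr (cbar s) g).
Proof.
rewrite /lower /diag /der /kappa addn0 mulrA /shift_ratio rmorphM/= fmorphV/=.
by rewrite !rmorph_nat mulrC [in RHS]mulrC [_^-1 * _]mulrC.
Qed.

Lemma bounded_lower s : bounded_map sphere_weight (lower s : (mindex -> C) -> _).
Proof.
exists 1 => // f M fM A; rewrite mul1r.
apply: le_trans (fM (incr (cbar s) @` A)%fset).
rewrite [leRHS]big_imfset/=; last by move=> g g' _ _; exact/can_inj/incrK.
apply: ler_sum => g _; rewrite /l2_term lowerE sphere_weight_incr.
set r := shift_ratio _ _; set x := f _.
have -> : (sphere_weight g)%:C * (r%:C * x * conjC (r%:C * x)) =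
    r%:C * ((sphere_weight g * r)%:C * (x * conjC x)).
  rewrite [conjC (_ * _)](_ : _ = r%:C * conjC x).
    by rewrite real_complexM; ring.
  by rewrite rmorphM/= conj_Creal ?complex_real.
rewrite ler_piMl ?lecR ?shift_ratio_le1// mulr_ge0 ?mul_conjC_ge0// lecR.
by rewrite mulr_ge0 ?shift_ratio_ge0//; exact/ltW/sphere_weight_gt0.
Qed.

(** Reindexing along [incr s] loses only indices with [g s = 0], where [mulx s f] vanishes, and
    turns the weight into [shift_ratio]. *)
Lemma adjoint_mulx s : adjoint_maps sphere_weight
  (mulx s : (mindex -> C) -> _) (lower (cbar s)).
Proof.
move=> f h f2 h2; symmetry; apply: coef_innerP.
have := has_sum_coef_inner (bounded_map_summable (bounded_mulx s) f2) h2.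
move=> /(has_sum_reindex (incrK s)) => H.
apply: eq_has_sum (H _) => [g|g].
  rewrite /= /l2_term lowerE cbarK sphere_weight_incr /mulx ffunE eqxx addn1/= incrK.
  set r := shift_ratio s g; rewrite [conjC (_ * _)](_ : _ = r%:C * conjC (h (incr s g))).
    by rewrite real_complexM; ring.
  by rewrite rmorphM/= conj_Creal ?complex_real.
move=> gs; rewrite /l2_term /mulx; case: eqVneq => [_|g0].
  by rewrite mul0r mulr0.
by rewrite decrK ?eqxx in gs.
Qed.

Lemma adjoint_lower s : adjoint_maps sphere_weight
  (lower s : (mindex -> C) -> _) (mulx (cbar s)).
Proof.
rewrite -{1}(cbarK s); apply: adjoint_maps_sym; last exact: adjoint_mulx.
  exact: bounded_mulx.
exact: bounded_lower.
Qed.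

Lemma bounded_rho : bounded_map sphere_weight (@rho R m).
Proof.
apply: bounded_map_sum => i; apply: bounded_map_comp; exact: bounded_mulx.
Qed.

Definition rho_adjoint f :=
  \sum_(i < m) lower (i, true) (lower (i, false) f).

Lemma adjoint_rho : adjoint_maps sphere_weight (@rho R m) rho_adjoint.
Proof.
apply: (@adjoint_maps_sum _ _ _ _ _ (fun i => mulx (i, true) \o mulx (i, false))
  (fun i => lower (i, true) \o lower (i, false))) => i.
- apply: bounded_map_comp; exact: bounded_mulx.
- apply: bounded_map_comp; exact: bounded_lower.
- apply: adjoint_maps_comp; try exact: bounded_mulx; try exact: bounded_lower.
    exact: (adjoint_mulx (i, true)).
  exact: (adjoint_mulx (i, false)).
Qed.

(** Up to [kappa] factors the adjoint of [rho] is the Laplacian, so the range of [rho] is orthogonal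
    to the harmonic families. *)
Lemma rho_adjoint_harmonic f : harmonic f -> rho_adjoint f = 0.
Proof.
move=> hf; transitivity (diag (kappa 0) (diag (kappa 1) (laplacian f))).
  rewrite -(laplacianE false) !linear_sum; apply: eq_bigr => i _.
  by rewrite /lower /cbar/= der_kappa.
by rewrite hf !linear0.
Qed.

Lemma bounded_mulz s : bounded_map sphere_weight (mulz s : (mindex -> C) -> _).
Proof.
apply: bounded_mapD; first exact: bounded_mapD (bounded_mulx s) (bounded_lower s).
by apply: bounded_mapN; apply: bounded_map_comp bounded_rho (bounded_lower s).
Qed.

(** Against a harmonic family the [rho] term of [mulz] drops out, and the adjoint exchanges the two
    remaining terms while conjugating the variable. *)
Lemma mulz_adjoint s f h : square_summable sphere_weight f ->
  square_summable sphere_weight h -> harmonic f -> harmonic h ->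
  coef_inner sphere_weight (mulz s f) h =
  coef_inner sphere_weight f (mulz (cbar s) h).
Proof.
move=> f2 h2 hf hh.
have sX t u (u2 : square_summable sphere_weight u) :=
  bounded_map_summable (bounded_mulx t) u2.
have sL t u (u2 : square_summable sphere_weight u) :=
  bounded_map_summable (bounded_lower t) u2.
have sZ t u (u2 : square_summable sphere_weight u) :=
  bounded_map_summable (bounded_mulz t) u2.
have sR u (u2 : square_summable sphere_weight u) :=
  bounded_map_summable bounded_rho u2.
have rho0 u v : square_summable sphere_weight u -> square_summable sphere_weight v ->
    harmonic v -> coef_inner sphere_weight (rho u) v = 0.
  by move=> u2 v2 hv; rewrite adjoint_rho// rho_adjoint_harmonic// coef_inner0r.
have left0 t u v : square_summable sphere_weight u -> square_summable sphere_weight v ->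
    harmonic v -> coef_inner sphere_weight (mulz t u) v =
    coef_inner sphere_weight (mulx t u) v + coef_inner sphere_weight (lower t u) v.
  move=> u2 v2 hv; have Xu := sX t u u2; have Lu := sL t u u2.
  have Zu := sZ t u u2; have Ru := sR _ Lu.
  have E : mulx t u + lower t u = mulz t u + rho (lower t u) by rewrite /mulz subrK.
  by rewrite -coef_innerDl// E [RHS]coef_innerDl// (rho0 (lower t u))// addr0.
have Zh := sZ (cbar s) h h2; have Xh := sX (cbar s) h h2.
have Lh := sL (cbar s) h h2.
rewrite left0// [RHS]coef_innerC// left0// rmorphD/= -!coef_innerC//.
by rewrite adjoint_mulx// adjoint_lower// addrC.
Qed.

Definition harmonic_pred : {pred mindex -> C} := [pred f | `[< harmonic f >]].

Lemma harmonicP f : reflect (harmonic f) (f \in harmonic_pred).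
Proof. exact: asboolP. Qed.

Lemma harmonic_submod : submod_closed harmonic_pred.
Proof.
split; first by apply/harmonicP; rewrite /harmonic linear0.
move=> k f h /harmonicP hf /harmonicP hh; apply/harmonicP.
by rewrite /harmonic laplacian_linear [laplacian f]hf [laplacian h]hh scaler0 addr0.
Qed.

(** A coefficient of the Laplacian involves only [m] coefficients of [f], so it is continuous for
    pointwise convergence. *)
Lemma harmonic_closed f : (forall (A : {fset mindex}) (e : C), 0 < e ->
    exists2 h, h \in harmonic_pred & forall g, g \in A -> `|f g - h g| < e) ->
  f \in harmonic_pred.
Proof.
move=> fH; apply/harmonicP/funext => g.
pose p i := incr (i, false) (incr (i, true) g).
pose c i : C := (g (i, true)).+1%:R * (incr (i, true) g (i, false)).+1%:R.
have lapE h : laplacian h g = \sum_(i < m) c i * h (p i).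
  rewrite /laplacian fct_sumE; apply: eq_bigr => i _.
  by rewrite /der mulrA.
have c0 i : 0 <= c i by rewrite mulr_ge0.
pose K := \sum_(i < m) c i; have K0 : 0 <= K by rewrite sumr_ge0.
apply/eqP; rewrite -normr_eq0; apply: contraT => nz.
have K1 : 0 < K + 1 by rewrite ltr_wpDl.
set L := `|laplacian f g| in nz *.
have L0 : 0 < L by rewrite lt_def nz normr_ge0.
have [h] := fH [fset p i | i in 'I_m]%fset _ (divr_gt0 L0 K1).
move=> /harmonicP hh fh.
have : L <= K * (L / (K + 1)).
  rewrite {1}/L (_ : laplacian f g = \sum_(i < m) c i * (f (p i) - h (p i))).
    apply: le_trans (ler_norm_sum _ _ _) _; rewrite mulr_suml.
    apply: ler_sum => i _; rewrite normrM ger0_norm// ler_wpM2l// ltW// fh//.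
    by rewrite in_imfset.
  under eq_bigr do rewrite mulrBr.
  by rewrite sumrB -!lapE hh subr0.
rewrite mulrCA ler_pMr// ler_pdivlMr// mul1r.
by rewrite gerDl ler10.
Qed.

Definition sphere_coef := CoefSpace harmonic_submod harmonic_closed.

End SphereOperators.

(** * The eigenvalues of the diagonal operator *)

Section Multipliers.
Variables (R : realType) (n : nat).
Local Notation m := n.+3.
Local Notation J := ('I_m * bool)%type.
Local Notation mindex := {ffun J -> nat}.
Implicit Types (g : mindex).

(** The product solution of the recurrence for the eigenvalues. Writing [m = n.+3] turns [m - 1]
    into [n.+2] and the decay exponent [m - 3] into [n]. *)
Definition nu (a : nat) : R :=
  (-1) ^+ a * \prod_(j < a) (j.+2%:R / (n.+2 + j)%:R).

Lemma nuS a : nu a.+1 * (n.+2 + a)%:R + a.+2%:R * nu a = 0.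
Proof.
rewrite /nu exprS big_ord_recr/=.
have : (n.+2 + a)%:R != 0 :> R by rewrite pnatr_eq0.
by move: (_ + _)%:R => x x0; field.
Qed.

Lemma nu_factE a : `|nu a| * (a + n.+1)`!%:R = (a.+1)`!%:R * (n.+1)`!%:R.
Proof.
elim: a => [|a IH].
  by rewrite /nu big_ord0 expr0 mulr1 normr1 add0n; congr (_ * _).
have x0 : 0 < (n.+2 + a)%:R :> R by rewrite ltr0n.
have -> : `|nu a.+1| = `|nu a| * (a.+2%:R / (n.+2 + a)%:R).
  rewrite -[X in _ = _ * X]ger0_norm ?divr_ge0// -normrM -normrN; congr `|_|.
  by rewrite /nu exprS big_ord_recr/=; ring.
have -> : (a.+1 + n.+1)`!%:R = (n.+2 + a)%:R * (a + n.+1)`!%:R :> R.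
  by rewrite addSn factS natrM -addnS [(a + n.+2)%N]addnC.
rewrite [in RHS]factS natrM -[in RHS]mulrA -IH.
by move: x0; move: (n.+2 + a)%:R => x x0; field; rewrite gt_eqF.
Qed.

(** The last [k] factors of the larger factorial are all at least [a.+2]. *)
Lemma fact_ge_exp a k : (a.+1`! * a.+2 ^ k <= (a + k.+1)`!)%N.
Proof.
elim: k => [|k IH]; first by rewrite expn0 muln1 addn1.
rewrite addnS factS expnS mulnCA leq_mul//.
by rewrite ltnS addnS ltnS leq_addr.
Qed.

Lemma nu_le a : `|nu a| <= n.+1`!%:R / a.+2%:R ^+ n.
Proof.
rewrite ler_pdivlMr ?exprn_gt0//.
have f0 : 0 < a.+1`!%:R :> R by rewrite ltr0n fact_gt0.
rewrite -(ler_pM2l f0) -nu_factE mulrCA ler_wpM2l// -natrX -natrM ler_nat.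
exact: fact_ge_exp.
Qed.

Lemma nu_le1 a : `|nu a| <= 1.
Proof.
have f0 : 0 < (a + n.+1)`!%:R :> R by rewrite ltr0n fact_gt0.
rewrite -(ler_pM2r f0) nu_factE mul1r -natrM ler_nat.
elim: a {f0} => [|a IH]; first by rewrite mul1n.
rewrite addSn [(a.+2)`!]factS [(_ + _).+1`!]factS -mulnA leq_mul//.
by rewrite ltnS addnS ltnS leq_addr.
Qed.

Definition sphere_multiplier g : R :=
  if bidegree false g == (bidegree true g).+1 then nu (bidegree true g) else 0.

Lemma coord_le_bidegree b i g : (g (i, b) <= bidegree b g)%N.
Proof. by rewrite /bidegree (bigD1 i)//= leq_addr. Qed.

(** A cube of multi-indices; its cardinality gives the polynomial bound on the multiplicities. *)
Definition box (N : nat) : seq mindex :=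
  [seq [ffun t => x t : nat] | x : {ffun J -> 'I_N} <- enum {ffun J -> 'I_N}].

Lemma size_box N : size (box N) = (N ^ (m * 2))%N.
Proof. by rewrite size_map -cardE card_ffun card_ord card_prod card_ord card_bool. Qed.

Lemma mem_box N g : (forall t, g t < N)%N -> g \in box N.
Proof.
move=> gN; apply/mapP; exists [ffun t => Ordinal (gN t)]; first by rewrite mem_enum.
by apply/ffunP => t; rewrite !ffunE.
Qed.

Lemma box_bidegree a g : bidegree true g = a -> bidegree false g = a.+1 ->
  g \in box a.+2.
Proof.
move=> ga gb; apply: mem_box => -[i []]; rewrite ltnS.
  by rewrite (leq_trans (coord_le_bidegree _ _ _))// ga.
by rewrite (leq_trans (coord_le_bidegree _ _ _))// gb.
Qed.

Lemma sphere_multiplier_le1 g : `|sphere_multiplier g| <= 1.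
Proof. by rewrite /sphere_multiplier; case: ifP => _; rewrite ?nu_le1// normr0. Qed.

Lemma sphere_multiplier_small : (0 < n)%N -> forall e : R, 0 < e ->
  exists A : {fset mindex}, forall g, g \notin A -> `|sphere_multiplier g| <= e.
Proof.
move=> n0 e e0.
(* From [a >= N] on, the bound of [nu_le] is below [e]. The box has side [N.+2] since the second
   bidegree exceeds the first by one. *)
pose N := Num.bound (n.+1`!%:R / e).
exists [fset g in box N.+2]%fset => g; rewrite inE => gN.
rewrite /sphere_multiplier; case: eqP => [gb|_]; last by rewrite normr0 ltW.
have Na : (N <= bidegree true g)%N.
  rewrite leqNgt; apply: contra gN => lt; apply: mem_box => -[i b].
  apply: leq_ltn_trans (coord_le_bidegree _ _ _) _.
  by case: b; rewrite ?gb; move: lt; clear; lia.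
apply: le_trans (nu_le _) _; set a := bidegree true g in Na *.
rewrite ler_pdivrMr ?exprn_gt0// mulrC -ler_pdivrMr//.
apply: le_trans (ltW (archi_boundP _)) _; first by rewrite divr_ge0// ltW.
rewrite -/N; apply: (@le_trans _ _ a.+2%:R).
  by rewrite ler_nat (leq_trans Na)// -addn2 leq_addr.
by rewrite -[leLHS]expr1 ler_weXn2l// ler1n.
Qed.

(** Telescoping, as [1/(a+2)^2 <= 1/(a+1) - 1/(a+2)]. *)
Lemma sum_inv_sqr N : \sum_(a < N) (a.+2%:R ^+ 2)^-1 <= 1 - N.+1%:R^-1 :> R.
Proof.
elim: N => [|N IH]; first by rewrite big_ord0 invr1 subrr.
rewrite big_ord_recr/=; apply: le_trans (lerD IH (lexx _)) _.
rewrite -subr_ge0 (_ : _ - _ = (N.+1%:R * N.+2%:R ^+ 2)^-1).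
  by rewrite invr_ge0 mulr_ge0// exprn_ge0.
have : N.+1%:R != 0 :> R by rewrite pnatr_eq0.
have : N.+2%:R != 0 :> R by rewrite pnatr_eq0.
rewrite -[N.+2%:R]natr1; move: N.+1%:R => x x1 x0.
by field; rewrite x0 x1.
Qed.

(** In the exponent, [2 m] will absorb the number of multi-indices with a given [a], and 2 leaves a
    summable series. *)
Lemma nu_powR_le (p : R) a : 0 < p -> (m * 2 + 2)%N%:R <= n%:R * p ->
  `|nu a| `^ p <= n.+1`!%:R `^ p * (a.+2%:R ^+ (m * 2 + 2))^-1.
Proof.
move=> p0 np.
have x1 : 1 <= a.+2%:R :> R by rewrite ler1n.
have x0 : 0 < a.+2%:R :> R by rewrite ltr0n.
apply: le_trans (ge0_ler_powR (ltW p0) _ _ (nu_le a)) _.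
- by rewrite nnegrE.
- by rewrite nnegrE divr_ge0// exprn_ge0.
rewrite powRM ?invr_ge0 ?exprn_ge0// ler_wpM2l ?powR_ge0//.
rewrite -!powR_mulrn ?(ltW x0)// -!powRN -powRrM mulNr.
by apply: ler_powR => //; rewrite lerN2.
Qed.

Lemma sphere_multiplier_sum (p : R) : 0 < p -> (m * 2 + 2)%N%:R <= n%:R * p ->
  forall A : {fset mindex},
    \sum_(g <- A) `|sphere_multiplier g| `^ p <= n.+1`!%:R `^ p.
Proof.
move=> p0 np A; set K := _ `^ p; have K0 : 0 <= K by exact: powR_ge0.
(* Any strict upper bound for the first bidegrees in [A] would do; the terms are then grouped by the
   value [a] of this bidegree. *)
pose N := (\sum_(g <- A) bidegree true g).+1.
have AN g : g \in A -> (bidegree true g < N)%N.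
  by move=> gA; rewrite ltnS (big_fsetD1 _ gA)/= leq_addr.
pose P a g := (bidegree true g == a) && (bidegree false g == a.+1).
have sumE : \sum_(g <- A) `|sphere_multiplier g| `^ p =
    \sum_(a < N) \sum_(g <- A | P a g) `|nu a| `^ p.
  rewrite (exchange_big_dep predT)//= big_seq [RHS]big_seq; apply: eq_bigr => g gA.
  rewrite /sphere_multiplier; case: ifPn => [/eqP gb|gb].
    rewrite (big_pred1 (Ordinal (AN g gA)))// => a.
    by rewrite /P gb /= -(inj_eq val_inj)/= eq_sym; case: eqP => // ->; rewrite eqxx.
  rewrite big_pred0 ?normr0 ?powR0 ?gt_eqF// => a.
  by rewrite /P; case: eqP => // <-; rewrite (negPf gb).
rewrite sumE; apply: (@le_trans _ _ (\sum_(a < N) K * (a.+2%:R ^+ 2)^-1)); last first.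
  rewrite -mulr_sumr ler_piMr// (le_trans (sum_inv_sqr N))//.
  by rewrite gerBl invr_ge0.
apply: ler_sum => a _; rewrite big_const_seq iter_addr_0 -[leLHS]mulr_natr.
have cnt : (count (P a) A <= a.+2 ^ (m * 2))%N.
  rewrite -size_box -size_filter; apply: uniq_leq_size.
    by rewrite filter_uniq// fset_uniq.
  move=> g; rewrite mem_filter => /andP[/andP[/eqP ga /eqP gb] _].
  exact: box_bidegree.
apply: (@le_trans _ _ (K * (a.+2%:R ^+ (m * 2 + 2))^-1 * a.+2%:R ^+ (m * 2))).
  apply: ler_pM; [exact: powR_ge0|by []|exact: nu_powR_le|].
  by rewrite -natrX ler_nat.
have x0 k : a.+2%:R ^+ k != 0 :> R by rewrite expf_neq0// pnatr_eq0.
rewrite exprD; move: (x0 (m * 2)%N) (x0 2%N).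
move: (_ ^+ (m * 2)) (_ ^+ 2) => y z y0 z0.
by rewrite [leLHS](_ : _ = K * z^-1)//; field; rewrite y0 z0.
Qed.

End Multipliers.

(** * The operators on the sphere *)

Section SphereExample.
Variables (R : realType) (n : nat).
Local Notation m := n.+3.
Local Notation C := R[i].
Local Notation J := ('I_m * bool)%type.
Local Notation mindex := {ffun J -> nat}.
Implicit Types (f h : mindex -> C) (g : mindex) (s t : J).

Let m_gt0 : (0 < m)%N := ltn0Sn n.+2.

Local Notation w := (sphere_weight R m_gt0).
Local Notation E := (sphere_coef R m).
Local Notation H := (l2_hilbert w E).

Lemma mulz_linear s : linear (mulz s : (mindex -> C) -> (mindex -> C)).
Proof.
move=> k f h; have rhoZ u : rho (k *: u) = k *: rho u :> (mindex -> C).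
  exact: linearZ.
rewrite /mulz /lower !linE rhoD rhoZ scalerBr scalerDr.
by apply/funext => g; rewrite !fctE; ring.
Qed.

Lemma mulz_preserves s f : f \in E -> mulz s f \in E.
Proof. by move=> /harmonicP hf; apply/harmonicP; exact: harmonic_mulz. Qed.

Definition coord_op s : bounded_operator H :=
  l2_operator (mulz_linear s) (bounded_mulz R m_gt0 s) (@mulz_preserves s).

Definition bidegree_multiplier (a b : nat) : C :=
  (if b == a.+1 then nu R n a else 0)%:C.

Definition multiplier g : C := (sphere_multiplier R g)%:C.

(** Lets the lemmas on multipliers be applied with [c] true for the vanishing sum and false for the
    other one. *)
Lemma multiplierE (c : bool) : multiplier = fun g =>
  (if c then bidegree_multiplier else fun a b => bidegree_multiplier b a)
    (bidegree c g + 0)%N (bidegree (~~ c) g + 0)%N.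
Proof. by apply/funext => g; rewrite !addn0; case: c. Qed.

Lemma bounded_multiplier : bounded_map w (diag multiplier).
Proof.
exists 1 => // f M fM A; rewrite mul1r; apply: le_trans (fM A).
apply: ler_sum => g _; rewrite /l2_term /diag.
rewrite ler_wpM2l ?(ltW (wC_gt0 _ _))// -!normCK normrM exprMn ler_piMl ?exprn_ge0//.
rewrite expr_le1// normc_def/= expr0n addr0 sqrtr_sqr lecR.
exact: sphere_multiplier_le1.
Qed.

Lemma multiplier_preserves f : f \in E -> diag multiplier f \in E.
Proof.
move=> /harmonicP hf; apply/harmonicP; rewrite (multiplierE true).
exact: (harmonic_multiplier bidegree_multiplier true 0 0 hf).
Qed.

Definition sphere_op : bounded_operator H :=
  l2_operator (diag_linear multiplier) bounded_multiplier multiplier_preserves.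

Lemma sphere_opE (u : l2_space w E) g :
  (sphere_op u : l2_space w E) g = (sphere_multiplier R g)%:C * u g.
Proof. by []. Qed.

Lemma coord_op_adjoint s : adjoint (coord_op s) = coord_op (cbar s).
Proof.
apply: adjointE => x y; apply: mulz_adjoint;
  by [exact: l2_square_summable|exact/harmonicP/l2_in_coef].
Qed.

Lemma coord_opC s t x : coord_op s (coord_op t x) = coord_op t (coord_op s x).
Proof. by apply/val_inj; exact: mulzC. Qed.

Lemma coord_op_normal s : normal_operator (coord_op s).
Proof. by move=> x; rewrite coord_op_adjoint coord_opC. Qed.

Lemma sum_coord_sphere_op x : \sum_(i < m) coord_op (i, false) (sphere_op (coord_op (i, true) x)) = 0.
Proof.
apply/val_inj; rewrite raddf_sum/=.
rewrite -[RHS](@sum_mulz_multiplier R m m_gt0 bidegree_multiplier true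
  (x : l2_space w E)).
- by apply: eq_bigr => i _ /=; rewrite (multiplierE true).
- by [].
(* On the support, where [b = a.+1], this is the recurrence [nuS]; elsewhere both terms are zero. *)
- move=> a b; rewrite /bidegree_multiplier eqSS; case: eqP => [->|_].
    rewrite addSn -natr1 addrK -!(rmorph_nat (real_complex R)).
    by rewrite -!rmorphM -rmorphD nuS rmorph0.
  by rewrite mul0r mulr0 addr0.
- exact/harmonicP/l2_in_coef.
Qed.

Definition one_coef g : C := (g == [ffun=> 0%N])%:R.

Lemma der_one s : der s one_coef = 0.
Proof.
apply/funext => g; rewrite /der /one_coef [_ == _](_ : _ = false) ?mulr0//.
by apply/eqP => /ffunP/(_ s); rewrite !ffunE eqxx addn1.
Qed.

Lemma one_l2 : one_coef \in l2_pred w E.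
Proof.
rewrite inE; apply/andP; split.
  apply/harmonicP; rewrite /harmonic /laplacian big1// => i _.
  by rewrite !der_one linear0.
apply/asboolP; exists (l2_term w one_coef one_coef [ffun=> 0%N]) => A.
apply: le_trans (ler_sum_fsubset (l2_term_ge0 w one_coef)
  (fsubsetUr [fset [ffun=> 0%N]]%fset A)) _.
rewrite -(big_fset_incl _ (fsubsetUl _ _)) ?big_seq_fset1// => g _.
by rewrite inE => /negPf g0; rewrite /l2_term /one_coef g0 mul0r mulr0.
Qed.

(** The derivatives of the constant 1 vanish, so [multiplier_mulz] has no defect on it; the sum is
    the constant [nu] at 0, which is 1. *)
Lemma sum_adjoint_coord_sphere_op (u := L2Space one_l2 : H) :
  \sum_(i < m) coord_op (i, true) (sphere_op (coord_op (i, false) u)) <> 0.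
Proof.
move=> /(congr1 (val : l2_space w E -> (mindex -> C))); rewrite raddf_sum/=.
pose mu a b := bidegree_multiplier b a.
pose M10 g := mu (bidegree false g + 1)%N (bidegree true g + 0)%N.
have one_harmonic : harmonic one_coef.
  by rewrite /harmonic /laplacian big1// => i _; rewrite !der_one linear0.
have -> : \sum_(i < m) mulz (i, true) (diag multiplier (mulz (i, false) one_coef)) =
    diag M10 one_coef.
  rewrite -[RHS](sum_mulz_mulz m_gt0 false
    (harmonic_multiplier mu false 1 0 one_harmonic)).
  apply: eq_bigr => i _; congr (mulz _ _); rewrite (multiplierE false).
  have diag0 phi : diag phi 0 = 0 :> (mindex -> C) by exact: linear0.
  by rewrite (multiplier_mulz mu false) der_one !diag0 subr0 diag0 addr0.
move=> /(congr1 (fun f => f [ffun=> 0%N])); rewrite /diag /M10 /one_coef eqxx mulr1.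
rewrite /bidegree !big1 => [|i _|i _]; rewrite ?ffunE//.
rewrite /mu /bidegree_multiplier /= /nu big_ord0 expr0 mulr1 => /eqP.
by rewrite oner_eq0.
Qed.

Lemma sphere_example : (0 < n)%N ->
  exists (K : hilbertType R) (A B : 'I_m -> bounded_operator K)
    (T : bounded_operator K),
  [/\ commutative_family A, commutative_family B,
      (forall i, normal_operator (A i)) /\ (forall i, normal_operator (B i)),
      compact_operator T /\ (forall p : R, 0 < p -> (m * 2 + 2)%N%:R <= n%:R * p ->
        schatten_class p T) &
      sum_vanishes_but_not_adjoint_sum A B T].
Proof.
(* Taking adjoints exchanges the two families, hence the two sums. *)
move=> n_gt0; exists H, (fun i => coord_op (i, false)), (fun i => coord_op (i, true)), sphere_op.
have Tc : compact_operator sphere_op.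
  apply: (diagonal_compact sphere_opE); first exact: sphere_multiplier_le1.
  exact: sphere_multiplier_small.
split; try by move=> *; exact: coord_opC.
- by split=> i; exact: coord_op_normal.
- split=> // p p0 np; split=> //.
  exists (2 * n.+1`!%:R `^ p) => k s; apply: (diagonal_singular_values sphere_opE) => //.
  exact: sphere_multiplier_sum.
- split; first exact: sum_coord_sphere_op.
  exists (L2Space one_l2 : H).
  under eq_bigr do rewrite !coord_op_adjoint.
  exact: sum_adjoint_coord_sphere_op.
Qed.

End SphereExample.

(** * Reduction of the numerical hypotheses to those of the sphere example *)

Theorem theorem6p5 (R : realType) :
  (forall (p : R) (m : nat),
    2 < p -> (24 * p - 12) / (p - 2) < m%:R ->
    exists (H : hilbertType R) (A B : 'I_m -> bounded_operator H)
           (T : bounded_operator H),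
      [/\ commutative_family A, commutative_family B,
          (forall i, normal_operator (A i)) /\
          (forall i, normal_operator (B i)),
          schatten_class p T &
          sum_vanishes_but_not_adjoint_sum A B T]) /\
  (forall m : nat,
    (25 <= m)%N ->
    exists (H : hilbertType R) (A B : 'I_m -> bounded_operator H)
           (T : bounded_operator H),
      [/\ commutative_family A, commutative_family B,
          (forall i, normal_operator (A i)) /\
          (forall i, normal_operator (B i)),
          compact_operator T &
          sum_vanishes_but_not_adjoint_sum A B T]).
Proof.
split=> [p m p2 hm|m m25]; last first.
  case: m m25 => [|[|[|n]]]// m25.
  have [|H [A [B [T [cA cB nAB [cT _] sAB]]]]] := @sphere_example R n; first by lia.
  by exists H, A, B, T.
have p20 : 0 < p - 2 by rewrite subr_gt0.
have mp : 24 * p - 12 < m%:R * (p - 2) by rewrite -ltr_pdivrMr.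
(* Since [24 p - 12 >= 24 (p - 2)], the hypothesis forces [m > 24], so [n = m - 3] is positive. *)
have m25 : (24 < m)%N.
  rewrite -(ltr_nat R) -(ltr_pM2r p20); apply: le_lt_trans mp.
  by rewrite mulrBr lerB//; lra.
case: m m25 hm mp => [|[|[|n]]]// m25 _ mp.
have [|H [A [B [T [cA cB nAB [_ sT] sAB]]]]] := @sphere_example R n; first by lia.
exists H, A, B, T.
split=> //; apply: sT; first by lra.
(* The goal [2 m + 2 <= (m - 3) p] amounts to [3 p + 2 <= m (p - 2)], and [24 p - 12] exceeds
   [3 p + 2] for [p > 2]. *)
move: mp; rewrite natrD natrM -[n.+3]addn3 natrD => mp.
have n0 : 0 <= n%:R :> R by [].
nra.
Qed.
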